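(* Suppose that for each $m\in\mathfrak M$, $U_m$ is Lipschitz continuous over $[a_m,b_m]$ with random Lipschitz modulus $L_m$ almost surely, where $\mathbb{E}[L_m]<\infty$, and suppose that $\Sigma_{I-1}$ is nonsingular. Let $\gamma_N$ monotonically decrease to $0$ as $N\to\infty$. Then for any $\alpha\in(0,1)$ and small $\epsilon>0$, there exist positive numbers $I_0(\epsilon)$, $N_0(\epsilon,\alpha)$ such that $$\mathrm{Prob}\left(|\vartheta_{\mathrm{elp}}-\vartheta|\ge\epsilon\right)\le\alpha$$ for all $N\ge N_0(\epsilon,\alpha)=O\left((\ln\alpha)/\epsilon^2\right)$ and $I\ge I_0(\epsilon)=O(1/\epsilon)$.
   Context: $\mathfrak M=\{1,\dots,M\}$ indexes the attributes. For each $m\in\mathfrak M$, $U_m$ is a continuous nondecreasing random utility function on $[a_m,b_m]$ with $U_m(a_m)=0$, and $U(x)=\sum_{m\in\mathfrak M}U_m(x_m)$ is normalized so that $U(a_1,\dots,a_M)=0$ and $U(b_1,\dots,b_M)=1$ almost surely. $\mathfrak X\subseteq[a_1,b_1]\times\cdots\times[a_M,b_M]$ is compact. $\vartheta:=\max_{x\in\mathfrak X}\mathbb{E}[U(x)]$. For each $m$ let $a_m=t_{m,0}<t_{m,1}<\cdots<t_{m,I_m}=b_m$ be breakpoints, $\mathfrak I_m=\{1,\dots,I_m\}$, $I=\sum_mI_m$, and $\Delta:=\max_{m}\max_{i\in\mathfrak I_m}(t_{m,i}-t_{m,i-1})$. It is assumed that the breakpoints are chosen so that $I\to\infty$ ensures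 $\Delta\to0$; for the order of $I_0$ the paper has in mind evenly spread breakpoints with $I_1=\cdots=I_M$, for which $\Delta\le\epsilon$ corresponds to $I\ge\max_{m}M(b_m-a_m)/\epsilon$. For $v=(v_1^T,\dots,v_M^T)^T\in\mathbb{R}^I$ let $$u_m(x_m;v_m)=\sum_{i\in\mathfrak I_m}\left[\frac{v_{m,i}}{t_{m,i}-t_{m,i-1}}(x_m-t_{m,i-1})+\sum_{j=1}^{i-1}v_{m,j}\right]\mathbf 1\{t_{m,i-1}<x_m\le t_{m,i}\},\qquad u(x;v)=\sum_{m\in\mathfrak M}u_m(x_m;v_m).$$ Let $V_{m,i}:=U_m(t_{m,i})-U_m(t_{m,i-1})$ and let $V\in\mathbb{R}^I$ be the random vector collecting the $V_{m,i}$; it takes values in $\mathcal V=\{v\in\mathbb{R}^I:e_I^Tv=1,\ v\ge0\}$ ($e_I$ the all-ones vector). $V^1,\dots,V^N$ is an i.i.d. random sample of $V$ with sample mean $\bar V$ and sample covariance matrix $S$. $C=[\,\mathrm{Id}_{I-1}\ |\ 0\,]$ is the $(I-1)\times I$ matrix extracting the first $I-1$ components, $\bar V_{I-1}=C\bar V$, $S_{I-1}=CSC^T$, and $\Sigma_{I-1}$ is the covariance matrix of $CV$. Define $$\mathfrak F(\mathcal P_A(\gamma_N)):=\left\{v\in\mathcal V:\ (Cv-\bar V_{I-1})^TS_{I-1}^{-1}(Cv-\bar V_{I-1})\le\gamma_N\right\},$$ which is the set of means $\mathbb{E}_P[V]$ over all probability measures $P$ on $\mathbb{R}^I$ with $P(V\in\mathcal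 V)=1$ and $\|S_{I-1}^{-1/2}(C\mathbb{E}_P[V]-\bar V_{I-1})\|^2\le\gamma_N$, and $$\vartheta_{\mathrm{elp}}:=\max_{x\in\mathfrak X}\ \min_{v\in\mathfrak F(\mathcal P_A(\gamma_N))}u(x;v),$$ which depends on $N$ and $I$. $\mathrm{Prob}$ refers to the randomness of the sample. $O(g)$ denotes a quantity bounded in absolute value by a constant times $|g|$.
   Formalization: The order of N_0 is corrected to N_0 ≤ max(K|ln α|/ε², n) for any n with γ_n ≤ ε²/K, K uniform for α ≤ α_1 < 1 (the stated order fails for slow γ_N and as α→1; it holds if γ_N = O(1/N)). The order of I_0 is for evenly spread breakpoints, I_1=…=I_M. *)

(* Defs.v *)
From HB Require Import structures.
From mathcomp Require Import all_boot all_order all_algebra.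
From mathcomp Require Import all_classical all_reals all_analysis.

Set Implicit Arguments.
Unset Strict Implicit.
Unset Printing Implicit Defensive.

Import Order.TTheory GRing.Theory Num.Theory.
Import numFieldNormedType.Exports.
Local Open Scope classical_set_scope.
Local Open Scope ring_scope.

Section Breakpoints.
Variables (R : realType) (M : nat).

(* [bp g m i] is t_{m,i}; it is meaningful for i <= npts g m, where
   npts g m = I_m. *)
Record grid := Grid { npts : 'I_M -> nat ; bp : 'I_M -> nat -> R }.

Definition is_grid (a b : 'I_M -> R) (g : grid) : Prop :=
  forall m : 'I_M,
    [/\ bp g m 0%N = a m,
        bp g m (npts g m) = b m &
        forall i, (i < npts g m)%N -> bp g m i < bp g m i.+1].

Definition gsize (g : grid) : nat := (\sum_(m < M) npts g m)%N.

Definition mesh (g : grid) : R :=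
  \big[Num.max/0]_(m < M) \big[Num.max/0]_(i < npts g m)
    (bp g m i.+1 - bp g m i).

Definition evenly_spread (a b : 'I_M -> R) (g : grid) : Prop :=
  (forall m m', npts g m = npts g m') /\
  (forall (m : 'I_M) (i : nat), (i <= npts g m)%N ->
    bp g m i = a m + i%:R * (b m - a m) / (npts g m)%:R).

(* The ordinal i : 'I_(npts g m) stands for the 1-based index i + 1, so that
   v_{m,i+1} is the entry [Rank i] of the stacked vector v. *)
Definition vcomp (g : grid) (v : 'cV[R]_(gsize g)) (m : 'I_M)
    (i : 'I_(npts g m)) : R :=
  v (@tagnat.Rank M (npts g) m i) 0.

Definition u_attr (g : grid) (v : 'cV[R]_(gsize g)) (m : 'I_M) (y : R) : R :=
  \sum_(i < npts g m)
    (vcomp v i / (bp g m i.+1 - bp g m i) * (y - bp g m i)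
     + \sum_(j < npts g m | (j < i)%N) vcomp v j)
    * ((bp g m i < y) && (y <= bp g m i.+1))%:R.

Definition u_add (g : grid) (v : 'cV[R]_(gsize g)) (x : 'rV[R]_M) : R :=
  \sum_(m < M) u_attr v m (x 0 m).

Definition increments (T : Type) (U : 'I_M -> T -> R -> R) (g : grid) (w : T) :
    'cV[R]_(gsize g) :=
  \col_s (U (tagnat.sig1 s) w (bp g (tagnat.sig1 s) (tagnat.sig2 s).+1)
          - U (tagnat.sig1 s) w (bp g (tagnat.sig1 s) (tagnat.sig2 s))).

End Breakpoints.

Section Sampling.
Variables (R : realType) (n : nat).

Definition simplex : set 'cV[R]_n :=
  [set v | \sum_i v i 0 = 1 /\ forall i, 0 <= v i 0].

(* C = [Id_{n-1} | 0] *)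
Definition drop_last : 'M[R]_(n.-1, n) := pid_mx n.-1.

Definition sample_mean (N : nat) (W : 'I_N -> 'cV[R]_n) : 'cV[R]_n :=
  N%:R^-1 *: \sum_k W k.

Definition sample_cov (N : nat) (W : 'I_N -> 'cV[R]_n) : 'M[R]_n :=
  (N%:R - 1)^-1 *:
    \sum_k (W k - sample_mean W) *m (W k - sample_mean W)^T.

(* d^T S^-1 d <= gamma.  A sample covariance matrix of size n.-1 is always
   singular when N < n, and then S^-1 has no meaning; for singular S the
   condition || S^{-1/2} d ||^2 <= gamma is read as: d lies in the range of S
   and d^T w <= gamma for a preimage w, d = S w (the same ellipsoid,
   degenerate, which is what both branches describe when S is invertible). *)
Definition in_ellipsoid (k : nat) (S : 'M[R]_k) (gamma : R) (d : 'cV[R]_k) :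
    Prop :=
  if S \in unitmx then is_true ((d^T *m invmx S *m d) 0 0 <= gamma)
  else exists2 w : 'cV[R]_k, d = S *m w & (d^T *m w) 0 0 <= gamma.

Definition mean_set (N : nat) (gamma : R) (W : 'I_N -> 'cV[R]_n) :
    set 'cV[R]_n :=
  [set v | simplex v /\
     in_ellipsoid (drop_last *m sample_cov W *m drop_last^T) gamma
       (drop_last *m v - drop_last *m sample_mean W)].

Definition borel_vec : set (set 'cV[R]_n) := <<s (@open 'cV[R]_n) >>.

(* W_1, ..., W_N, on the sample space (T', Q), are independent copies of the
   random vector V on (T, P). *)
Definition iid_copies d (T : measurableType d) (P : probability T R)
    (V : T -> 'cV[R]_n) d' (T' : measurableType d') (Q : probability T' R)
    (N : nat) (W : 'I_N -> T' -> 'cV[R]_n) : Prop :=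
  [/\ forall k A, borel_vec A -> measurable (W k @^-1` A),
      forall k A, borel_vec A -> Q (W k @^-1` A) = P (V @^-1` A) &
      forall A : 'I_N -> set 'cV[R]_n, (forall k, borel_vec (A k)) ->
        Q (\bigcap_k (W k @^-1` A k)) = (\prod_(k < N) Q (W k @^-1` A k))%E].

Definition cov_mx d (T : measurableType d) (P : probability T R) (k : nat)
    (V : T -> 'cV[R]_k) : 'M[R]_k :=
  \matrix_(i, j) fine (covariance P (fun w => V w i 0) (fun w => V w j 0)).

End Sampling.

Section Values.
Variables (R : realType) (M : nat).

(* Both suprema and the infimum below are attained under the standing
   assumptions (compact nonempty feasible sets, continuous objectives). *)
Definition theta d (T : measurableType d) (P : probability T R)
    (U : 'I_M -> T -> R -> R) (X : set 'rV[R]_M) : R :=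
  sup [set fine 'E_P[fun w => \sum_(m < M) U m w (x 0 m)] | x in X].

Definition theta_elp (g : grid R M) (X : set 'rV[R]_M) (gamma : R) (N : nat)
    (W : 'I_N -> 'cV[R]_(gsize g)) : R :=
  sup [set inf [set u_add v x | v in mean_set gamma W] | x in X].

End Values.

(* N_0(eps, alpha) = O(|ln alpha| / eps^2), with a constant uniform in eps and
   in alpha bounded away from 1 (|ln alpha| vanishes at alpha = 1), up to the
   first index at which gamma_N has dropped to the order eps^2: the set of
   means has radius sqrt(gamma_N) around the sample mean, so no N with
   gamma_N >> eps^2 can be sufficient.  When gamma_N = O(1/N) that index is
   itself O(1/eps^2), see [sample_size_order_bigO]. *)
Definition sample_size_order (R : realType) (gamma : nat -> R) (eps0 : R)
    (N0 : R -> R -> R) : Prop :=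
  forall alpha1 : R, 0 < alpha1 < 1 -> exists2 K : R, 0 < K &
    forall eps alpha : R, 0 < eps < eps0 -> 0 < alpha <= alpha1 ->
    forall n : nat, gamma n <= eps ^+ 2 / K ->
      N0 eps alpha <= Num.max (K * (`|ln alpha| / eps ^+ 2)) n%:R.

Lemma sample_size_order_bigO (R : realType) (gamma : nat -> R) (eps0 : R)
    (N0 : R -> R -> R) (c : R) :
  (forall n, (0 < n)%N -> gamma n <= c / n%:R) ->
  sample_size_order gamma eps0 N0 ->
  forall alpha1 : R, 0 < alpha1 < 1 -> exists2 K : R, 0 < K &
    forall eps alpha : R, 0 < eps < eps0 -> 0 < alpha <= alpha1 ->
      N0 eps alpha <= K * (`|ln alpha| / eps ^+ 2).
Proof.
move=> hg hN alpha1 ha1; have [K K0 hK] := hN _ ha1.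
case/andP: (ha1) => a10 a11.
have l1 : 0 < `|ln alpha1|.
  by rewrite normr_gt0 ln_eq0 // lt_eqF.
set c' := `|c| + 1.
have c'0 : 0 < c' by rewrite ltr_wpDl.
exists (Num.max K ((c' * K + eps0 ^+ 2) / `|ln alpha1|)).
  by rewrite lt_max K0.
move=> eps alpha he ha; case/andP: (he) => e0 ee0; case/andP: (ha) => a0 aa1.
have e20 : 0 < eps ^+ 2 by rewrite exprn_gt0.
have l1l : `|ln alpha1| <= `|ln alpha|.
  have aa : alpha <= 1 by apply: le_trans aa1 (ltW a11).
  by rewrite !ler0_norm ?ln_le0 ?(ltW a11) // lerN2 ler_ln ?posrE.
have x0 : 0 <= c' * K / eps ^+ 2.
  by rewrite divr_ge0 ?mulr_ge0 ?ltW.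
have /andP[nl nu] := truncn_itv x0.
set n := (Num.truncn (c' * K / eps ^+ 2)).+1 in nu.
have gn : gamma n <= eps ^+ 2 / K.
  apply: le_trans (hg n isT) _.
  rewrite ler_pdivrMr ?ltr0n // mulrAC ler_pdivlMr //.
  apply: (@le_trans _ _ (c' * K)).
    by rewrite ler_pM2r // (le_trans (ler_norm _)) // lerDl.
  by rewrite -ler_pdivrMl // mulrC ltW.
apply: le_trans (hK _ _ he ha n gn) _.
rewrite ge_max; apply/andP; split.
  by rewrite ler_wpM2r ?divr_ge0 ?le_max ?lexx // ltW.
set D := c' * K + eps0 ^+ 2.
have D0 : 0 <= D by rewrite addr_ge0 ?sqr_ge0 ?mulr_ge0 ?ltW.
have step : n%:R <= D / eps ^+ 2.
  rewrite mulrDl -natr1 lerD // ler_pdivlMr // mul1r.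
  by rewrite ler_pXn2r // ?nnegrE ltW // (lt_trans e0).
apply: le_trans step _; rewrite mulrA ler_pM2r ?invr_gt0 //.
apply: (@le_trans _ _ (D / `|ln alpha1| * `|ln alpha|)).
  by rewrite mulrAC ler_pdivlMr // ler_wpM2l.
by rewrite ler_wpM2r ?le_max ?lexx ?orbT.
Qed.

(* Main.v *)
Require Import Defs.
From HB Require Import structures.
From mathcomp Require Import all_boot all_order all_algebra.
From mathcomp Require Import all_classical all_reals all_analysis.
From mathcomp Require Import measurable_realfun ring lra.
Import Order.TTheory GRing.Theory Num.Theory.
Import numFieldNormedType.Exports.
Local Open Scope classical_set_scope.
Local Open Scope ring_scope.
Set Implicit Arguments.
Unset Strict Implicit.
Unset Printing Implicit Defensive.

(** Both optimal values are suprema over the same set of alternatives x, so it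
    suffices to compare, uniformly in x, the worst case of u(x; v) over the
    set of means with the expected utility of x.  The function u(x; v) is
    linear in v, with coefficients in [0, 1] given by ramps ([hat],
    [piecewise_linear_hat]).  Let psi_m be the mean of U_m.  It is
    nondecreasing and E[L_m]-Lipschitz, and three errors appear.

    - Radius of the set of means.  A point v of the ellipsoid has
      v - mean = S w with w^T S w <= gamma, so a linear functional with values
      in [0, 1] on the simplex moves by at most the square root of gamma times
      its sample standard deviation ([ellipsoid_deviation]).  The bound is
      deterministic and free of the number of breakpoints.

    - Sampling.  The deviation of the sample mean of u_m(y; V) from its
      expectation has to be small simultaneously for all y, with a sample size
      that depends neither on the grid nor on more than 1 / eps^2.  A union
      bound over 1 / eps points would cost an extra factor ln (1 / eps), so
      the bound is chained over dyadic cells ([dyadic_chaining]).  The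
      increment over a cell of level j is a [0, 1]-valued variable of mean at
      most Lam / 2^j, hence its sample mean is off by 2 t with probability at
      most 2 exp (- N t^2 / (8 Lam / 2^j)) as long as t <= 2 Lam / 2^j
      ([iid_concentration]).  With t proportional to eps (3/4)^j the
      deviations add up to a multiple of eps, and the exponents grow like
      (9/8)^j, which beats the number 2^j of cells ([chaining_tail_sum]).  The
      chain stops at the level 2^j of order 1 / eps, where monotonicity and
      the Lipschitz bound on psi_m take over and where t is still within the
      admissible range ([uniform_deviation]).

    - Discretisation.  The piecewise linear interpolant of psi_m stays within
      E[L_m] times the mesh of psi_m ([interpolation_error]).

    Independence of the sample is only given as a product rule for events.
    Rounding the variables to finitely many values turns their exponential
    moments into finite sums, for which this rule suffices
    ([finite_mgf_iid]). *)

(** * An exponential inequality for finitely valued variables *)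

(** The factor (1 - z)(1 + z + 2 z^2) exceeds 1 by z^2 (1 - 2 z), and
    exp z <= 1 / (1 - z). *)
Lemma expR_le_quadratic (R : realType) (z : R) :
  z <= 2^-1 -> expR z <= 1 + z + 2 * z ^+ 2.
Proof.
move=> z2; have h := expR_ge1Dx (- z); rewrite expRN in h.
have e0 := expR_gt0 z.
have {}h : (1 - z) * expR z <= 1.
  by rewrite -ler_pdivlMr // mul1r.
have q : 1 <= (1 - z) * (1 + z + 2 * z ^+ 2).
  have -> : (1 - z) * (1 + z + 2 * z ^+ 2) = 1 + z ^+ 2 * (1 - 2 * z) by ring.
  rewrite lerDl mulr_ge0 ?sqr_ge0 //; lra.
have z1 : 0 < 1 - z by lra.
by rewrite -(ler_pM2l z1) (le_trans h).
Qed.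

Section FiniteChernoff.
Variables (R : realType) (J : finType) (q y : J -> R).
Hypothesis q_ge0 : forall j, 0 <= q j.
Hypothesis q_sum : \sum_j q j <= 1.
Hypothesis y01 : forall j, 0 <= y j <= 1.
Let mu := \sum_j q j * y j.

(** As y takes its values in [0, 1], y^2 <= y: the mean dominates the variance,
    and a small mean therefore yields a small exponent. *)
Lemma finite_mgf (lam : R) : lam <= 2^-1 ->
  \sum_j q j * expR (lam * (y j - mu)) <= expR (2 * lam ^+ 2 * mu).
Proof.
move=> hl.
have -> : \sum_j q j * expR (lam * (y j - mu)) =
    (\sum_j q j * expR (lam * y j)) * expR (- (lam * mu)).
  rewrite mulr_suml; apply: eq_bigr => j _.
  by rewrite mulrBr expRD mulrA.
rewrite expRN ler_pdivrMr ?expR_gt0 // -expRD.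
apply: le_trans (expR_ge1Dx _).
apply: (@le_trans _ _ (\sum_j q j * (1 + lam * y j + 2 * lam ^+ 2 * y j))).
  apply: ler_sum => j _; apply: ler_wpM2l => //.
  have /andP[y0 y1] := y01 j.
  have lyj : lam * y j <= 2^-1.
    have [l0|l0] := leP 0 lam; first nra.
    by apply: le_trans (_ : 0 <= _) => //; nra.
  apply: le_trans (expR_le_quadratic lyj) _.
  have yy : y j ^+ 2 <= y j by rewrite expr2 ler_piMr.
  rewrite lerD2l exprMn mulrA; apply: ler_wpM2l => //.
  by rewrite mulr_ge0 ?sqr_ge0.
rewrite [leLHS](_ : _ = \sum_j q j + (lam + 2 * lam ^+ 2) * mu).
  rewrite [leRHS](_ : _ = 1 + (lam + 2 * lam ^+ 2) * mu) ?lerD2r //; ring.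
rewrite /mu mulr_sumr -big_split /=; apply: eq_bigr => j _; ring.
Qed.

(** Summing a product of weights over all sequences of values factorises. *)
Lemma finite_mgf_iid (N : nat) (lam : R) : lam <= 2^-1 ->
  \sum_(l : {ffun 'I_N -> J})
    (\prod_k q (l k)) * expR (lam * \sum_k (y (l k) - mu))
  <= expR (N%:R * (2 * lam ^+ 2 * mu)).
Proof.
move=> hl.
have -> : \sum_(l : {ffun 'I_N -> J})
    (\prod_k q (l k)) * expR (lam * \sum_k (y (l k) - mu)) =
  \prod_(k < N) \sum_j q j * expR (lam * (y j - mu)).
  rewrite bigA_distr_bigA /=; apply: eq_bigr => l _.
  by rewrite mulr_sumr expR_sum -big_split.
rewrite prodr_const card_ord expRM_natl.
apply: lerXn2r; rewrite ?nnegrE ?expR_ge0 //.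
  by apply: sumr_ge0 => j _; rewrite mulr_ge0 ?expR_ge0.
exact: finite_mgf.
Qed.

(** Markov's inequality for the exponential moments at lam and - lam.  The
    condition t <= 2 p keeps the optimal lam in the range where the quadratic
    bound on the exponential holds; there the tail is Gaussian with variance
    proxy of order p. *)
Lemma finite_chernoff (N : nat) (p t : R) : mu <= p -> 0 < t -> t <= 2 * p ->
  \sum_(l : {ffun 'I_N -> J} | N%:R * t <= `|\sum_k (y (l k) - mu)|)
    \prod_k q (l k)
  <= 2 * expR (- (N%:R * (t ^+ 2 / (8 * p)))).
Proof.
move=> mup t0 tp.
have p0 : 0 < p by lra.
(* The minimiser of 2 lam^2 p - lam t. *)
pose lam := t / (4 * p).
have l0 : 0 < lam by rewrite divr_gt0 // mulr_gt0.
have l2 : lam <= 2^-1 by rewrite ler_pdivrMr ?mulr_gt0 //; lra.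
have lE : lam * t - 2 * lam ^+ 2 * p = t ^+ 2 / (8 * p).
  by rewrite /lam; field; rewrite gt_eqF.
pose E s := \sum_(l : {ffun 'I_N -> J})
    (\prod_k q (l k)) * expR (s * lam * \sum_k (y (l k) - mu)).
have EB s : s ^+ 2 = 1 -> s * lam <= 2^-1 ->
    E s <= expR (N%:R * (2 * lam ^+ 2 * p)).
  move=> s1 sl; apply: le_trans (finite_mgf_iid _ sl) _.
  rewrite ler_expR ler_wpM2l // exprMn s1 mul1r.
  by rewrite ler_wpM2l // mulr_ge0 // sqr_ge0.
have key : \sum_(l : {ffun 'I_N -> J} | N%:R * t <= `|\sum_k (y (l k) - mu)|)
    \prod_k q (l k) <= (E 1 + E (-1)) * expR (- (N%:R * (lam * t))).
  rewrite /E -big_split /= mulr_suml.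
  rewrite [leRHS](bigID (fun l : {ffun 'I_N -> J} =>
     N%:R * t <= `|\sum_k (y (l k) - mu)|)) /=.
  rewrite -[leLHS]addr0 lerD //; last first.
    apply: sumr_ge0 => l _; rewrite mulr_ge0 ?expR_ge0 // -mulrDr.
    by rewrite mulr_ge0 ?addr_ge0 ?expR_ge0 // prodr_ge0.
  apply: ler_sum => l; set s := \sum_k _ => hs.
  rewrite -mulrDr -mulrA ler_peMr ?prodr_ge0 // mulrDl -!expRD.
  have [s0|s0] := leP 0 s.
    rewrite ger0_norm // in hs.
    apply: le_trans (_ : expR 0 <= _); first by rewrite expR0.
    rewrite -[leLHS]addr0 lerD ?expR_ge0 // ler_expR; nra.
  rewrite ltr0_norm // in hs.
  apply: le_trans (_ : expR 0 <= _); first by rewrite expR0.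
  rewrite -[leLHS]add0r lerD ?expR_ge0 // ler_expR; nra.
apply: le_trans key _.
have -> : - (N%:R * (t ^+ 2 / (8 * p))) =
    N%:R * (2 * lam ^+ 2 * p) - N%:R * (lam * t) by rewrite -lE; ring.
rewrite expRD [leRHS]mulrA ler_pM2r ?expR_gt0 //.
have E1 : E 1 <= expR (N%:R * (2 * lam ^+ 2 * p)).
  by apply: EB; rewrite ?expr1n // mul1r.
have E2 : E (-1) <= expR (N%:R * (2 * lam ^+ 2 * p)).
  by apply: EB; [rewrite sqrrN expr1n | lra].
by lra.
Qed.

End FiniteChernoff.

(** * Concentration of independent copies *)

Lemma borel_vec_open (R : realType) (n : nat) (A : set 'cV[R]_n) :
  open A -> borel_vec A.
Proof. exact: sub_sigma_algebra. Qed.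

Lemma borel_vec_itvco (R : realType) (n : nat) (f : 'cV[R]_n -> R) (x y : R) :
  continuous f -> borel_vec (f @^-1` `[x, y[).
Proof.
move=> fc.
have lt_borel z : borel_vec (f @^-1` [set r | r < z]).
  apply: borel_vec_open; apply: open_comp (@open_lt _ z) => v _; exact: fc.
have -> : f @^-1` `[x, y[ =
    (f @^-1` [set r | r < y]) `\` (f @^-1` [set r | r < x]).
  apply/seteqP; split=> v /=; rewrite in_itv /=.
    by case/andP=> xv ->; split=> //; apply/negP; rewrite -leNgt.
  by case=> -> /negP; rewrite -leNgt => ->.
exact: (@measurableD _ (g_sigma_algebraType (@open 'cV[R]_n)) _ _
  (lt_borel y) (lt_borel x)).
Qed.

(** A union bound with outer measure on the left, because the events of interest
    involve suprema and infima and need not be measurable. *)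
Lemma mu_ext_subadditive d (T : measurableType d) (R : realType)
    (Q : probability T R) (I : finType) (C : pred I) (F : I -> set T)
    (E : set T) (r : I -> R) :
  (forall w, E w -> exists2 i, C i & F i w) ->
  (forall i, C i -> (mu_ext Q (F i) <= (r i)%:E)%E) ->
  (mu_ext Q E <= (\sum_(i | C i) r i)%:E)%E.
Proof.
move=> EF Fr.
pose F' i := if C i then F i else set0.
pose G k := oapp (fun i : 'I_#|I| => F' (enum_val i)) set0 (insub k).
apply: (@le_trans _ _ (mu_ext Q (\big[setU/set0]_(k < #|I|) G k))).
  apply: le_mu_ext => w /EF[i Ci Fi].
  rewrite -bigcup_mkord; exists (enum_rank i) => //=.
  by rewrite /G valK /= enum_rankK /F' Ci.
apply: le_trans (outer_measure_subadditive _ _ _) _.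
rewrite -sumEFin [leRHS]big_mkcond [leRHS](reindex _ (onW_bij _ (@enum_val_bij I))) /=.
apply: lee_sum => k _; rewrite /G valK /= /F'.
by case: ifP => Ck; [exact: Fr | rewrite mu_ext0].
Qed.

Section Binning.
Context d (T : measurableType d) (R : realType) (P : probability T R).
Variables (Z : T -> R) (mu : R) (m : nat).
Hypothesis m_gt0 : (0 < m)%N.
Hypothesis Zmeas : measurable_fun setT Z.
Hypothesis Z_ge0 : forall w, 0 <= Z w.
Hypothesis Z_le1 : {ae P, forall w, Z w <= 1}.
Hypothesis EZ : ('E_P[Z] = mu%:E)%E.

(** The bins round Z down to a multiple of 1 / m.  There are m + 1 of them on
    [0, 1], the last one only for the value 1. *)
Definition bin (l : nat) : set R := `[l%:R / m%:R, l.+1%:R / m%:R[%classic.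

Definition prob_bin (l : 'I_m.+1) : R := fine (P (Z @^-1` bin l)).

Lemma unit_interval_bin (z : R) : 0 <= z <= 1 ->
  exists2 l0 : 'I_m.+1, forall l : 'I_m.+1, bin l z <-> l = l0 &
    l0%:R / m%:R <= z <= l0%:R / m%:R + m%:R^-1.
Proof.
case/andP=> z0 z1; have m0 : 0 < m%:R :> R by rewrite ltr0n.
have zm0 : 0 <= z * m%:R by rewrite mulr_ge0 // ltW.
have /andP[l1 l2] := truncn_itv zm0.
have binE (l : 'I_m.+1) : bin l z <-> l%:R <= z * m%:R < l.+1%:R.
  by rewrite /bin /= in_itv /= ler_pdivrMr // ltr_pdivlMr.
have lm : (Num.truncn (z * m%:R) < m.+1)%N.
  by rewrite -(ltr_nat R); apply: le_lt_trans l1 _; rewrite -natr1; nra.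
exists (Ordinal lm) => /=.
  move=> l; split=> [/binE/andP[h1 h2]|->]; last by apply/binE/andP.
  apply/val_inj/eqP; rewrite /= eqn_leq -[(l <= _)%N]ltnS -[(_ <= l)%N]ltnS.
  by rewrite -!(ltr_nat R) (le_lt_trans h1) // (le_lt_trans l1).
rewrite ler_pdivrMr // l1 /= -[X in _ + X]mul1r -mulrDl ler_pdivlMr //.
by rewrite natr1 ltW.
Qed.

Lemma measurable_bin l : measurable (Z @^-1` bin l).
Proof. by rewrite -[_ @^-1` _]setTI; apply: Zmeas => //; exact: measurable_itv. Qed.

(* The rounded variable, with c l as its value on bin l and 0 beyond the bins. *)
Let step (c : 'I_m.+1 -> R) (w : T) : \bar R :=
  (\sum_(l < m.+1) (c l)%:E * (\1_(Z @^-1` bin l) w)%:E)%E.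

Lemma stepE c w : Z w <= 1 ->
  exists2 l : 'I_m.+1, step c w = (c l)%:E &
    l%:R / m%:R <= Z w <= l%:R / m%:R + m%:R^-1.
Proof.
move=> Zw; have [|l0 hl0 hZ] := @unit_interval_bin (Z w); first by rewrite Z_ge0.
exists l0 => //; rewrite /step (bigD1 l0) //= big1 ?adde0 => [|l ll0].
  by rewrite indicE mem_set ?mule1 //; exact/hl0.
rewrite indicE memNset ?mule0 // => /hl0 ll.
by rewrite ll eqxx in ll0.
Qed.

Lemma integral_step c : (forall l, 0 <= c l) ->
  (\int[P]_w step c w)%E = (\sum_l c l * prob_bin l)%:E.
Proof.
move=> c0; rewrite ge0_integral_sum //.
- rewrite -sumEFin; apply: eq_bigr => l _.
  rewrite ge0_integralZl //.
  + rewrite integral_indic //; last exact: measurable_bin.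
    by rewrite setIT EFinM fineK // fin_num_measure //; exact: measurable_bin.
  + by apply/measurable_EFinP; apply: measurable_indic; exact: measurable_bin.
  + by rewrite lee_fin.
- move=> l; apply/measurable_EFinP; apply: measurable_funM => //.
  by apply: measurable_indic; exact: measurable_bin.
- by move=> l w _; rewrite -EFinM lee_fin mulr_ge0.
Qed.

Lemma step_ge0 c w : (forall l, 0 <= c l) -> (0 <= step c w)%E.
Proof. by move=> c0; apply: sume_ge0 => l _; rewrite -EFinM lee_fin mulr_ge0. Qed.

Lemma measurable_step c : measurable_fun setT (step c).
Proof.
apply: emeasurable_sum => l; apply/measurable_EFinP.
apply: measurable_funM => //.
by apply: measurable_indic; exact: measurable_bin.
Qed.

Lemma prob_bin_ge0 l : 0 <= prob_bin l.
Proof. exact: fine_ge0. Qed.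

Lemma prob_bin_sum : \sum_l prob_bin l <= 1.
Proof.
rewrite -lee_fin (_ : \sum_l _ = \sum_l 1 * prob_bin l); last first.
  by apply: eq_bigr => l _; rewrite mul1r.
rewrite -integral_step // -(@probability_setT _ _ _ P) -[leRHS]mul1e -integral_cst //.
apply: ae_ge0_le_integral => //.
- by move=> w _; exact: step_ge0.
- exact: measurable_step.
- by apply: filterS Z_le1 => w Zw _ /=; have [l -> _] := stepE (fun=> 1) Zw.
Qed.

Lemma bin_mean_le : \sum_l prob_bin l * (l%:R / m%:R) <= mu.
Proof.
rewrite -lee_fin (eq_bigr (fun l : 'I_m.+1 => (l%:R / m%:R) * prob_bin l)); last first.
  by move=> l _; rewrite mulrC.
rewrite -(@integral_step (fun l : 'I_m.+1 => l%:R / m%:R)) => [|l]; last first.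
  by rewrite divr_ge0.
rewrite -EZ unlock; apply: ae_ge0_le_integral => //.
- by move=> w _; apply: step_ge0 => l; rewrite divr_ge0.
- exact: measurable_step.
- by move=> w _; rewrite lee_fin.
- exact/measurable_EFinP.
- apply: filterS Z_le1 => w Zw _ /=.
  have [l -> /andP[h _]] := stepE (fun l : 'I_m.+1 => l%:R / m%:R) Zw.
  by rewrite lee_fin.
Qed.

Lemma le_bin_mean : mu <= \sum_l prob_bin l * (l%:R / m%:R) + m%:R^-1.
Proof.
have m0 : 0 <= m%:R^-1 :> R by rewrite invr_ge0.
have c0 (l : 'I_m.+1) : 0 <= l%:R / m%:R + m%:R^-1 :> R by rewrite addr_ge0 ?divr_ge0.
apply: (@le_trans _ _ (\sum_(l < m.+1) (l%:R / m%:R + m%:R^-1) * prob_bin l)).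
  rewrite -lee_fin -(@integral_step (fun l : 'I_m.+1 => l%:R / m%:R + m%:R^-1)) //.
  rewrite -EZ unlock; apply: ae_ge0_le_integral => //.
  - by move=> w _; rewrite lee_fin.
  - exact/measurable_EFinP.
  - by move=> w _; exact: step_ge0.
  - exact: measurable_step.
  - apply: filterS Z_le1 => w Zw _ /=.
    have [l -> /andP[_ h]] := stepE (fun l : 'I_m.+1 => l%:R / m%:R + m%:R^-1) Zw.
    by rewrite lee_fin.
under eq_bigr do rewrite mulrDl.
rewrite big_split /= lerD //.
  by apply: ler_sum => l _; rewrite mulrC.
by rewrite -mulr_sumr ler_piMr // prob_bin_sum.
Qed.

End Binning.

(** Rounding f (W k) down to a multiple of 1 / m <= t changes each centred
    summand by at most t, so a mean deviation of 2 t forces a deviation of t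
    for the rounded variables.  Their joint law is a product by the product
    rule on bins, which reduces the claim to [finite_chernoff]. *)
Lemma iid_concentration (R : realType) (n : nat)
    d (T : measurableType d) (P : probability T R) (V : T -> 'cV[R]_n)
    d' (T' : measurableType d') (Q : probability T' R)
    (N : nat) (W : 'I_N -> T' -> 'cV[R]_n) (f : 'cV[R]_n -> R) (mu p t : R) :
  iid_copies P V Q W -> continuous f ->
  measurable_fun setT (f \o V) -> (forall w, 0 <= f (V w)) ->
  {ae P, forall w, f (V w) <= 1} -> ('E_P[f \o V] = mu%:E)%E ->
  mu <= p -> 0 < t -> t <= 2 * p ->
  (mu_ext Q [set w | ((forall k, 0 <= f (W k w) <= 1) /\
     N%:R * (2 * t) <= `|\sum_k (f (W k w) - mu)|)%R]
   <= (2 * expR (- (N%:R * (t ^+ 2 / (8 * p)))))%:E)%E.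
Proof.
move=> [Wmeas Wlaw Windep] fc fmeas f0 f1 Ef mup t0 tp.
pose m := (Num.truncn t^-1).+1.
have mt : m%:R^-1 <= t.
  rewrite -[leRHS]invrK lef_pV2 ?posrE ?invr_gt0 ?ltr0n //.
  have /truncn_itv/andP[_ h] : 0 <= t^-1 by rewrite invr_ge0 ltW.
  exact: ltW.
have m0 : (0 < m)%N by [].
pose q : 'I_m.+1 -> R := fun l => prob_bin P (f \o V) l.
pose y (l : 'I_m.+1) : R := l%:R / m%:R.
pose nu := \sum_l q l * y l.
have nu1 : nu <= mu by exact: (bin_mean_le m0 fmeas f0 f1 Ef).
have nu2 : mu <= nu + m%:R^-1 by exact: (le_bin_mean m0 fmeas f0 f1 Ef).
have q0 l : 0 <= q l by exact: prob_bin_ge0.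
have q1 : \sum_l q l <= 1 by exact: (prob_bin_sum m0 fmeas f0 f1).
have y01 l : 0 <= y l <= 1.
  by rewrite /y divr_ge0 //= ler_pdivrMr ?ltr0n // mul1r ler_nat -ltnS.
have chern := finite_chernoff q0 q1 y01 N (le_trans nu1 mup) t0 tp.
apply: le_trans (_ : _ <= (\sum_(l : {ffun 'I_N -> 'I_m.+1} |
  N%:R * t <= `|\sum_k (y (l k) - nu)|) \prod_k q (l k))%:E)%E _; last by rewrite lee_fin.
have Bb (l : 'I_m.+1) : borel_vec (f @^-1` @bin R m l) by exact: borel_vec_itvco.
apply: (mu_ext_subadditive
  (F := fun l : {ffun 'I_N -> 'I_m.+1} => \bigcap_k (W k @^-1` (f @^-1` @bin R m (l k))))).
  move=> w [w01 dev].
  have bk k := unit_interval_bin m0 (w01 k).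
  pose l := [ffun k => s2val (cid2 (bk k))].
  have lk k : @bin R m (l k) (f (W k w)).
    by rewrite /l ffunE; case: cid2 => l0 /= h _; exact/h.
  have lk2 k : y (l k) <= f (W k w) <= y (l k) + m%:R^-1.
    by rewrite /l ffunE /y; case: cid2 => l0.
  exists l; last by move=> k _; exact: lk.
  rewrite /=.
  have close : `|\sum_k (f (W k w) - mu) - \sum_k (y (l k) - nu)| <= N%:R * t.
    rewrite -sumrB (le_trans (ler_norm_sum _ _ _)) //.
    rewrite mulr_natl -[X in _ *+ X]card_ord -sumr_const ler_sum // => k _.
    have /andP[h1 h2] := lk2 k; rewrite ler_norml; apply/andP; split; lra.
  have := ler_normD (\sum_k (f (W k w) - mu) - \sum_k (y (l k) - nu))
    (\sum_k (y (l k) - nu)); rewrite subrK; lra.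
move=> l _; rewrite measurable_mu_extE; last first.
  by apply: fin_bigcap_measurable => // k _; exact: Wmeas.
rewrite [X in (X <= _)%E](Windep (fun k => f @^-1` @bin R m (l k)) (fun k => Bb _)).
rewrite -prodEFin le_eqVlt; apply/orP; left; apply/eqP; apply: eq_bigr => k _.
rewrite Wlaw // /q /prob_bin fineK // fin_num_measure //.
exact: (measurable_bin m fmeas).
Qed.

(** * Dyadic chaining for monotone functions *)

Section DyadicChaining.
Variables (R : realType) (phi psi : R -> R) (t : nat -> R) (Lam : R) (J : nat).
Let dy (j i : nat) : R := i%:R / 2 ^+ j.
Hypothesis phi_mono : forall s s', 0 <= s -> s <= s' -> s' <= 1 -> phi s <= phi s'.
Hypothesis psi_mono : forall s s', 0 <= s -> s <= s' -> s' <= 1 -> psi s <= psi s'.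
Hypothesis psi_lip : forall s s', 0 <= s -> s <= s' -> s' <= 1 ->
  psi s' - psi s <= Lam * (s' - s).
Hypothesis eq0 : phi 0 = psi 0.
Hypothesis t_ge0 : forall j, 0 <= t j.
Hypothesis increment_le : forall j i, (j <= J)%N -> (i < 2 ^ j)%N ->
  `|(phi (dy j i.+1) - phi (dy j i)) - (psi (dy j i.+1) - psi (dy j i))| <= t j.

(** A point of level j + 1 is a point of level j or the right neighbour, at level
    j + 1, of such a point: each level costs a single increment. *)
Lemma dyadic_point_le j i : (j <= J)%N -> (i <= 2 ^ j)%N ->
  `|phi (dy j i) - psi (dy j i)| <= \sum_(l < j.+1) t l.
Proof.
elim: j i => [|j IH] i jJ ij.
  rewrite big_ord1.
  case: i ij => [|[|//]] _; rewrite /dy expr0 divr1; first by rewrite eq0 subrr normr0.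
  have := @increment_le 0 0 jJ isT.
  rewrite /dy expr0 !divr1 eq0; congr (`|_| <= _); ring.
have even k : dy j.+1 k.*2 = dy j k.
  rewrite /dy -muln2 natrM exprS; field.
  by rewrite expf_neq0.
have IHj k : (k <= 2 ^ j)%N ->
    `|phi (dy j.+1 k.*2) - psi (dy j.+1 k.*2)| <= \sum_(l < j.+1) t l.
  by move=> kj; rewrite even IH // ltnW.
rewrite big_ord_recr /=.
move: ij; rewrite -(odd_double_half i) expnS mul2n.
case: (odd i) => /=; rewrite ?add0n ?add1n.
  rewrite ltn_double => kj.
  have h : (i./2.*2 < 2 ^ j.+1)%N by rewrite expnS mul2n ltn_double.
  have {}h := increment_le jJ h.
  have hk := IHj _ (ltnW kj).
  move: h hk; set a := phi _; set b := phi (dy _ _.*2).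
  set c := psi _; set e := psi (dy _ _.*2) => h hk.
  have -> : a - c = (b - e) + ((a - b) - (c - e)) by ring.
  by rewrite (le_trans (ler_normD _ _)) // lerD.
rewrite leq_double => kj; apply: le_trans (IHj _ kj) _.
by rewrite lerDl.
Qed.

(** Inside a cell of the last level, monotonicity squeezes both functions
    between their values at the end points, where psi varies by Lam / 2^J. *)
Lemma dyadic_chaining s : 0 <= s <= 1 ->
  `|phi s - psi s| <= \sum_(l < J.+1) t l + Lam / 2 ^+ J.
Proof.
case/andP=> s0 s1; have p0 : 0 < 2 ^+ J :> R by rewrite exprn_gt0.
have Lam0 : 0 <= Lam.
  have := psi_lip (lexx 0) ler01 (lexx 1); rewrite subr0 mulr1.
  by apply: le_trans; rewrite subr_ge0; exact: psi_mono.
have B i : (i <= 2 ^ J)%N -> `|phi (dy J i) - psi (dy J i)| <= \sum_(l < J.+1) t l.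
  exact: dyadic_point_le.
have /truncn_itv/andP[] : 0 <= s * 2 ^+ J by rewrite mulr_ge0 // ltW.
set i := Num.truncn _ => h1 h2.
have il : (i <= 2 ^ J)%N.
  rewrite -(ler_nat R) natrX (le_trans h1) //.
  by rewrite ler_piMl // ltW.
have ds : dy J i <= s by rewrite /dy ler_pdivrMr.
have d0 k : 0 <= dy J k by rewrite /dy divr_ge0 // ltW.
have [ilt|ige] := ltnP i (2 ^ J); last first.
  have iE : dy J i = 1.
    have -> : i = (2 ^ J)%N by apply/eqP; rewrite eqn_leq il.
    by rewrite /dy natrX divff // gt_eqF.
  have -> : s = dy J i by apply/eqP; rewrite eq_le ds iE s1.
  by apply: le_trans (B _ il) _; rewrite lerDl divr_ge0 // ltW.
have sd : s <= dy J i.+1 by rewrite /dy ler_pdivlMr // ltW.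
have d1 : dy J i.+1 <= 1 by rewrite /dy ler_pdivrMr // mul1r -natrX ler_nat.
have dd : dy J i.+1 - dy J i = (2 ^+ J)^-1.
  by rewrite /dy -mulrBl -natr1 addrAC subrr add0r mul1r.
have := B i il; have := B i.+1 ilt.
rewrite !ler_norml => /andP[b1 b2] /andP[b3 b4].
have m1 := phi_mono (d0 _) ds s1.
have m2 := phi_mono s0 sd d1.
have m3 := psi_mono (d0 _) ds s1.
have m4 := psi_mono s0 sd d1.
have := psi_lip (d0 i) (le_trans ds sd) d1; rewrite dd => m5.
by apply/andP; split; lra.
Qed.

End DyadicChaining.

Lemma geometric_sum_le (R : realType) (r : R) n : 0 <= r -> r < 1 ->
  \sum_(j < n) r ^+ j <= (1 - r)^-1.
Proof.
move=> r0 r1; have r10 : 0 < 1 - r by rewrite subr_gt0.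
have -> : \sum_(j < n) r ^+ j = (1 - r ^+ n) / (1 - r).
  elim: n => [|n IH]; first by rewrite big_ord0 expr0 subrr mul0r.
  by rewrite big_ord_recr /= IH exprS; field; rewrite gt_eqF.
have rn1 : 1 - r ^+ n <= 1 by rewrite lerBlDr lerDl exprn_ge0.
by rewrite ler_piMl // invr_ge0 ltW.
Qed.

(** By Bernoulli (9/8)^j >= 1 + j / 8, so x >= 24 makes the exponential at level
    j smaller than that at level 0 by exp (- 3 j) <= 4^(-j), more than enough
    to compensate for 2^j. *)
Lemma chaining_tail_sum (R : realType) (x : R) n : 24 <= x ->
  \sum_(j < n) 2 ^+ j * expR (- (x * (9 / 8) ^+ j)) <= 2 * expR (- x).
Proof.
move=> hx.
have bern j : 1 + j%:R / 8 <= (9 / 8) ^+ j :> R.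
  elim: j => [|j IH]; first by rewrite expr0 mul0r addr0.
  have j0 : 0 <= j%:R :> R by [].
  by rewrite exprS -natr1; lra.
have e3 : 2 * expR (- 3) <= 2^-1 :> R.
  have e4 : 4 <= expR 3 :> R by apply: le_trans (expR_ge1Dx _); lra.
  rewrite expRN ler_pdivrMr ?expR_gt0 //; lra.
apply: (@le_trans _ _ (\sum_(j < n) expR (- x) * 2^-1 ^+ j)); last first.
  rewrite -mulr_sumr mulrC ler_wpM2r ?expR_ge0 //.
  apply: le_trans (geometric_sum_le n _ _) _; rewrite ?invr_ge0 //; last first.
    by rewrite [X in X^-1](_ : _ = 2^-1) ?invrK //; field.
  by rewrite invf_lt1 // ltr1n.
apply: ler_sum => j _.
apply: (@le_trans _ _ (2 ^+ j * (expR (- x) * expR (- 3) ^+ j))).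
  rewrite ler_wpM2l ?exprn_ge0 // -expRM_natl -expRD ler_expR.
  have := bern j; have j0 : 0 <= j%:R :> R by [].
  nra.
rewrite mulrCA ler_wpM2l ?expR_ge0 // -exprMn.
by rewrite lerXn2r // nnegrE ?mulr_ge0 ?expR_ge0 ?invr_ge0.
Qed.

Lemma pow2_between (R : realType) (z : R) : 1 <= z ->
  exists J : nat, z <= 2 ^+ J <= 2 * z.
Proof.
move=> z1; have ex : exists J : nat, z <= 2 ^+ J.
  have /truncn_itv/andP[_ zn] : 0 <= z by exact: le_trans z1.
  exists (Num.truncn z).+1; apply: le_trans (ltW zn) _.
  by rewrite -natrX ler_nat ltnW // ltn_expl.
case: (ex_minnP ex) => J zJ minJ; exists J; rewrite zJ /=.
case: J zJ minJ => [|J] zJ minJ; first by rewrite expr0; lra.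
rewrite exprS ler_pM2l // leNgt; apply/negP => h.
by have := minJ J (ltW h); rewrite ltnn.
Qed.

(** * The set of means *)

Section Ellipsoid.
Variables (R : realType) (n : nat).
Implicit Types (c d v : 'cV[R]_n).

Definition pairing c v : R := \sum_i c i 0 * v i 0.

Lemma pairingB c v v' : pairing c (v - v') = pairing c v - pairing c v'.
Proof. by rewrite -sumrB; apply: eq_bigr => i _; rewrite !mxE mulrBr. Qed.

Lemma pairingBl c c' v : pairing (c - c') v = pairing c v - pairing c' v.
Proof. by rewrite -sumrB; apply: eq_bigr => i _; rewrite !mxE mulrBl. Qed.

Lemma pairing_simplex c v : @simplex R n v -> (forall i, 0 <= c i 0 <= 1) ->
  0 <= pairing c v <= 1.
Proof.
move=> [v1 v0] c01; apply/andP; split.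
  by apply: sumr_ge0 => i _; have /andP[? _] := c01 i; rewrite mulr_ge0.
rewrite -v1; apply: ler_sum => i _.
by have /andP[_ ?] := c01 i; rewrite ler_piMl.
Qed.

(** On vectors of zero sum the last coordinate is minus the sum of the others, so
    c may be replaced by c - c_last, which vanishes at the dropped position. *)
Lemma pairing_drop_last c : exists h : 'cV[R]_n.-1, forall d,
  \sum_i d i 0 = 0 -> pairing c d = (h^T *m (drop_last R n *m d)) 0 0.
Proof.
rewrite /pairing /drop_last; case: n c => [|n'] c /=.
  by exists 0 => d _; rewrite big_ord0 trmx0 mul0mx mxE.
exists (\col_i (c (widen_ord (leqnSn n') i) 0 - c ord_max 0)) => d d0.
have dE i : ((pid_mx n' : 'M[R]_(n', n'.+1)) *m d) i 0 =
    d (widen_ord (leqnSn n') i) 0.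
  rewrite mxE (bigD1 (widen_ord (leqnSn n') i)) //= big1 => [|j ji].
    by rewrite mxE eqxx ltn_ord mul1r addr0.
  rewrite mxE; case: eqP => [e|]; last by rewrite mul0r.
  by case/eqP: ji; apply/val_inj.
rewrite mxE; under [RHS]eq_bigr do rewrite dE !mxE mulrBl.
rewrite sumrB -mulr_sumr big_ord_recr /=; congr (_ + _).
by move: d0; rewrite big_ord_recr /= => /eqP; rewrite addrC addr_eq0 => /eqP ->; rewrite mulrN.
Qed.

(** The regular and the singular reading of the ellipsoid both provide a preimage
    w of d under S with d^T w <= gamma. *)
Lemma in_ellipsoidP (S : 'M[R]_n.-1) (gamma : R) (d : 'cV[R]_n.-1) :
  in_ellipsoid S gamma d ->
  exists2 w, d = S *m w & (d^T *m w) 0 0 <= gamma.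
Proof.
rewrite /in_ellipsoid; case: ifP => // Su h.
by exists (invmx S *m d); rewrite ?mulmxA // mulmxV // mul1mx.
Qed.

Section Sample.
Variables (N : nat) (W : 'I_N -> 'cV[R]_n).
Hypothesis W_simplex : forall k, @simplex R n (W k).

Lemma pairing_sample_mean c :
  pairing c (sample_mean W) = N%:R^-1 * \sum_k pairing c (W k).
Proof.
rewrite /pairing exchange_big /= mulr_sumr; apply: eq_bigr => i _.
by rewrite !mxE summxE mulrCA mulr_sumr.
Qed.

Lemma sample_mean_simplex : (0 < N)%N -> @simplex R n (sample_mean W).
Proof.
move=> N0; split.
  have := pairing_sample_mean (const_mx 1); rewrite /pairing.
  under eq_bigr do rewrite mxE mul1r.
  move=> ->; under eq_bigr do under eq_bigr do rewrite mxE mul1r.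
  under eq_bigr do rewrite (W_simplex _).1.
  by rewrite sumr_const card_ord mulVf // pnatr_eq0 -lt0n.
move=> i; rewrite !mxE mulr_ge0 ?invr_ge0 // summxE.
by apply: sumr_ge0 => k _; have [_] := W_simplex k.
Qed.

Lemma sample_mean_in_mean_set gamma : (0 < N)%N -> 0 <= gamma ->
  mean_set gamma W (sample_mean W).
Proof.
move=> N0 g0; split; first exact: sample_mean_simplex.
rewrite /in_ellipsoid subrr; case: ifP => _.
  by rewrite trmx0 !mul0mx mxE.
by exists 0; rewrite ?mulmx0 ?mxE.
Qed.

Lemma sample_cov_form (h g : 'cV[R]_n.-1) :
  (h^T *m (drop_last R n *m sample_cov W *m (drop_last R n)^T *m g)) 0 0 =
  (N%:R - 1)^-1 * \sum_k
    (h^T *m (drop_last R n *m (W k - sample_mean W))) 0 0 *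
    (g^T *m (drop_last R n *m (W k - sample_mean W))) 0 0.
Proof.
rewrite /sample_cov -scalemxAr -!scalemxAl -scalemxAr mxE; congr (_ * _).
rewrite mulmx_sumr !mulmx_suml mulmx_sumr summxE; apply: eq_bigr => k _.
set u := W k - _; set C := drop_last R n.
have -> : h^T *m (C *m (u *m u^T) *m C^T *m g) =
    (h^T *m (C *m u)) *m (g^T *m (C *m u))^T.
  by rewrite !trmx_mul trmxK !mulmxA.
by rewrite mxE big_ord1; congr (_ * _); rewrite mxE.
Qed.

(** Writing v - mean = S w, the difference of the pairings is the sample
    covariance of the functionals h and w.  The sample variance of h is at most
    N / (N - 1) <= 2 since its values lie in [0, 1], that of w is at most gamma.
    The inequality of arithmetic and geometric means, with weight tau, replaces
    Cauchy-Schwarz and avoids square roots; the best tau is of the order of the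
    square root of gamma. *)
Lemma ellipsoid_deviation c v (gamma tau : R) : (1 < N)%N ->
  (forall i, 0 <= c i 0 <= 1) -> 0 < tau -> mean_set gamma W v ->
  `|pairing c v - pairing c (sample_mean W)| <= tau + gamma / (2 * tau).
Proof.
move=> N1 c01 tau0 [vs /in_ellipsoidP[w dS wg]].
have N0 : (0 < N)%N by exact: ltn_trans N1.
have ms := sample_mean_simplex N0.
have [h hE] := pairing_drop_last c.
set C := drop_last R n in hE dS wg.
pose al k := pairing c (W k - sample_mean W).
pose be k := (w^T *m (C *m (W k - sample_mean W))) 0 0.
have sub0 u u' : @simplex R n u -> @simplex R n u' -> \sum_i (u - u') i 0 = 0.
  move=> [u1 _] [u1' _]; under eq_bigr do rewrite !mxE.
  by rewrite sumrB u1 u1' subrr.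
have alE k : (h^T *m (C *m (W k - sample_mean W))) 0 0 = al k.
  by rewrite -hE //; exact: sub0.
have N10 : 0 < N%:R - 1 :> R by rewrite subr_gt0 ltr1n.
have XE : pairing c v - pairing c (sample_mean W) =
    (N%:R - 1)^-1 * \sum_k al k * be k.
  rewrite -pairingB hE; last exact: sub0.
  rewrite mulmxBr dS sample_cov_form; congr (_ * _).
  by apply: eq_bigr => k _; rewrite alE.
have wSw : (N%:R - 1)^-1 * \sum_k be k ^+ 2 <= gamma.
  have dw : ((C *m v - C *m sample_mean W)^T *m w) 0 0 =
      (w^T *m (C *m v - C *m sample_mean W)) 0 0.
    by rewrite !mxE; apply: eq_bigr => i _; rewrite !mxE mulrC.
  rewrite dw dS sample_cov_form in wg; apply: le_trans wg.
  by rewrite le_eqVlt; apply/orP; left; apply/eqP; congr (_ * _); apply: eq_bigr.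
have al1 k : al k ^+ 2 <= 1.
  rewrite /al pairingB.
  have /andP[a0 a1] := pairing_simplex (W_simplex k) c01.
  have /andP[b0 b1] := pairing_simplex ms c01.
  nra.
have alS : (N%:R - 1)^-1 * \sum_k al k ^+ 2 <= 2.
  rewrite mulrC ler_pdivrMr //.
  apply: le_trans (ler_sum _ (fun k _ => al1 k)) _.
  rewrite sumr_const card_ord.
  have : 2 <= N%:R :> R by rewrite (ler_nat _ 2).
  lra.
have amgm : \sum_k `|al k * be k| <=
    tau / 2 * \sum_k al k ^+ 2 + (2 * tau)^-1 * \sum_k be k ^+ 2.
  rewrite !mulr_sumr -big_split /=; apply: ler_sum => k _.
  rewrite normrM -(real_normK (num_real (al k))) -(real_normK (num_real (be k))).
  set x := `|al k|; set y := `|be k|.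
  have -> : tau / 2 * x ^+ 2 + (2 * tau)^-1 * y ^+ 2 =
    x * y + (2 * tau)^-1 * (tau * x - y) ^+ 2 by field; rewrite gt_eqF.
  by rewrite lerDl mulr_ge0 ?sqr_ge0 // invr_ge0 mulr_ge0 // ltW.
rewrite XE normrM gtr0_norm ?invr_gt0 //.
apply: (@le_trans _ _ ((N%:R - 1)^-1 *
  (tau / 2 * \sum_k al k ^+ 2 + (2 * tau)^-1 * \sum_k be k ^+ 2))).
  apply: ler_wpM2l; first by rewrite invr_ge0 ltW.
  exact: le_trans (ler_norm_sum _ _ _) amgm.
rewrite mulrDr mulrCA [X in _ + X]mulrCA lerD //.
  by rewrite -ler_pdivlMl ?divr_gt0 // invf_div mulrAC -mulrA divff ?mulr1 // gt_eqF.
by rewrite mulrC ler_wpM2r // invr_ge0 mulr_ge0 // ltW.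
Qed.

End Sample.
End Ellipsoid.

(** * Piecewise linear interpolation *)

Section HatFunctions.
Variables (R : realType) (n : nat) (t : nat -> R).
Hypothesis t_lt : forall i, (i < n)%N -> t i < t i.+1.

(** The ramp that climbs from 0 to 1 on [t_i, t_(i+1)] and is constant on either
    side.  Minima make it a single formula, monotone in y. *)
Definition hat (i : nat) (y : R) : R :=
  (Num.min y (t i.+1) - Num.min y (t i)) / (t i.+1 - t i).

Lemma knot_le i j : (i <= j)%N -> (j <= n)%N -> t i <= t j.
Proof.
elim: j => [|j IH] ij jn; first by move: ij; rewrite leqn0 => /eqP ->.
move: ij; rewrite leq_eqVlt => /orP[/eqP -> //|ij].
by rewrite (le_trans (IH ij (ltnW jn))) // ltW // t_lt.
Qed.

Lemma hat_mono i y y' : (i < n)%N -> y <= y' -> hat i y <= hat i y'.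
Proof.
move=> /t_lt ti yy'; rewrite /hat; apply: ler_wpM2r.
  by rewrite invr_ge0 subr_ge0 ltW.
by rewrite /Num.min; do !case: ltP => ?; lra.
Qed.

Lemma hat01 i y : (i < n)%N -> 0 <= hat i y <= 1.
Proof.
move=> /t_lt ti; apply/andP; split; rewrite /hat.
  apply: divr_ge0; last by rewrite subr_ge0 ltW.
  by rewrite /Num.min; do !case: ltP => ?; lra.
rewrite ler_pdivrMr ?subr_gt0 // mul1r.
by rewrite /Num.min; do !case: ltP => ?; lra.
Qed.

(** Each term is the length of the part of the cell that lies to the left of y;
    this is what turns slope bounds on cells into a global Lipschitz bound. *)
Lemma sum_hat y :
  \sum_(i < n) (t i.+1 - t i) * hat i y = Num.min y (t n) - Num.min y (t 0).
Proof.
rewrite -(telescope_sumr (fun i => Num.min y (t i))) // big_mkord.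
apply: eq_bigr => i _; rewrite /hat mulrC divfK //.
by rewrite subr_eq0 gt_eqF // t_lt.
Qed.

Lemma knot_interval y : t 0 < y -> y <= t n ->
  exists2 k, (k < n)%N & t k < y <= t k.+1.
Proof.
have : forall j, (j <= n)%N -> t 0 < y -> y <= t j ->
    exists2 k, (k < n)%N & t k < y <= t k.+1.
  elim=> [|j IH] jn y0 yj; first by have := lt_le_trans y0 yj; rewrite ltxx.
  have [yj'|yj'] := leP y (t j); first by apply: IH => //; exact: ltnW.
  by exists j => //; rewrite yj'.
by apply.
Qed.

Lemma sum_hat_interval (v : 'I_n -> R) y (k : 'I_n) : t k < y <= t k.+1 ->
  \sum_(i < n) v i * hat i y =
  \sum_(i < n | (i < k)%N) v i + v k * ((y - t k) / (t k.+1 - t k)).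
Proof.
case/andP=> ky yk; have tk := t_lt (ltn_ord k).
rewrite (bigID (fun i : 'I_n => (i < k)%N)) /=; congr (_ + _).
  apply: eq_bigr => i ik; rewrite /hat.
  have ti := t_lt (ltn_ord i); have tik := knot_le ik (ltnW (ltn_ord k)).
  rewrite !min_r; [|lra|lra].
  by rewrite divff ?mulr1 // subr_eq0 gt_eqF.
rewrite (bigD1 k) ?ltnn //= big1 ?addr0 => [|i /andP[]].
  by rewrite /hat (min_l yk) min_r // ltW.
rewrite -leqNgt => ki ik; rewrite /hat.
have {}ki : (k.+1 <= i)%N.
  by rewrite ltn_neqAle ki andbT; apply: contra ik => /eqP ki'; apply/eqP/val_inj.
have tki := knot_le ki (ltnW (ltn_ord i)); have ti := t_lt (ltn_ord i).
rewrite !min_l; [|lra|lra].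
by rewrite subrr mul0r mulr0.
Qed.

Lemma sum_hat_left (v : 'I_n -> R) : \sum_(i < n) v i * hat i (t 0) = 0.
Proof.
rewrite big1 // => i _.
have h1 := knot_le (leq0n i) (ltnW (ltn_ord i)).
have h2 := knot_le (leq0n i.+1) (ltn_ord i).
by rewrite /hat !min_l // subrr mul0r mulr0.
Qed.

(** The value at y accumulates the full increments of the cells on the left of y
    and a fraction of the increment of its own cell.  At y = t 0 no indicator
    fires and no ramp has started. *)
Lemma piecewise_linear_hat (v : 'I_n -> R) y : t 0 <= y -> y <= t n ->
  \sum_(i < n) (v i / (t i.+1 - t i) * (y - t i) + \sum_(j < n | (j < i)%N) v j)
     * ((t i < y) && (y <= t i.+1))%:R
  = \sum_(i < n) v i * hat i y.
Proof.
rewrite le_eqVlt => /orP[/eqP <-|y0] yn.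
  rewrite sum_hat_left big1 // => i _.
  by rewrite ltNge (knot_le (leq0n i) (ltnW (ltn_ord i))) mulr0.
have [k0 kn tk] := knot_interval y0 yn.
pose k := Ordinal kn.
rewrite (@sum_hat_interval v y k) // (bigD1 k) //= tk mulr1 [X in _ + X = _]big1 ?addr0 => [|i ik].
  by rewrite addrC -mulrA [_^-1 * _]mulrC.
case/andP: tk => tk1 tk2.
have [ilk|kli] := ltnP i k.
  have tik := knot_le ilk (ltnW kn).
  by rewrite [y <= _]leNgt (le_lt_trans tik tk1) andbF mulr0.
have {}kli : (k.+1 <= i)%N.
  by rewrite ltn_neqAle kli andbT; apply: contra ik => /eqP ki'; apply/eqP/val_inj.
have tki := knot_le kli (ltnW (ltn_ord i)).
by rewrite ltNge (le_trans tk2 tki) mulr0.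
Qed.

Section Interpolation.
Variables (psi : R -> R) (ell mesh : R).
Hypothesis psi_mono : forall y y', t 0 <= y -> y <= y' -> y' <= t n ->
  psi y <= psi y'.
Hypothesis psi_lip : forall y y', t 0 <= y -> y <= y' -> y' <= t n ->
  psi y' - psi y <= ell * (y' - y).
Hypothesis ell_ge0 : 0 <= ell.

Lemma interpolant_mono y y' : y <= y' ->
  \sum_(i < n) (psi (t i.+1) - psi (t i)) * hat i y <=
  \sum_(i < n) (psi (t i.+1) - psi (t i)) * hat i y'.
Proof.
move=> yy'; apply: ler_sum => i _; apply: ler_wpM2l; last exact: hat_mono.
rewrite subr_ge0; apply: psi_mono; first exact: knot_le (ltnW (ltn_ord i)).
  exact/ltW/t_lt.
exact: knot_le (ltn_ord i) (leqnn _).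
Qed.

(** On each cell the slope of the interpolant is a difference quotient of psi. *)
Lemma interpolant_lip y y' : t 0 <= y -> y <= y' -> y' <= t n ->
  \sum_(i < n) (psi (t i.+1) - psi (t i)) * (hat i y' - hat i y)
  <= ell * (y' - y).
Proof.
move=> y0 yy' yn.
apply: (@le_trans _ _ (\sum_(i < n) ell * (t i.+1 - t i) * (hat i y' - hat i y))).
  apply: ler_sum => i _; apply: ler_wpM2r; first by rewrite subr_ge0 hat_mono.
  apply: psi_lip; first exact: knot_le (ltnW (ltn_ord i)).
    exact/ltW/t_lt.
  exact: knot_le (ltn_ord i) (leqnn _).
under eq_bigr do rewrite -mulrA mulrBr mulrBr.
rewrite sumrB -!mulr_sumr !sum_hat -mulrBr.
rewrite (min_l yn) (min_l (le_trans yy' yn)) (min_r y0).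
rewrite (min_r (le_trans y0 yy')) le_eqVlt; apply/orP; left.
by apply/eqP; congr (_ * _); ring.
Qed.

(** On a cell both psi and its interpolant stay between the values of psi at the
    two end points, which differ by at most ell times the length of the cell. *)
Lemma interpolation_error y : t 0 <= y -> y <= t n ->
  (forall i, (i < n)%N -> t i.+1 - t i <= mesh) -> 0 <= mesh ->
  `|\sum_(i < n) (psi (t i.+1) - psi (t i)) * hat i y - (psi y - psi (t 0))|
  <= ell * mesh.
Proof.
rewrite le_eqVlt => /orP[/eqP <-|y0] yn hmesh mesh0.
  by rewrite sum_hat_left !subrr normr0 mulr_ge0.
have [k0 kn tk] := knot_interval y0 yn.
rewrite (@sum_hat_interval _ y (Ordinal kn)) //=.
have -> : \sum_(i < n | (i < k0)%N) (psi (t i.+1) - psi (t i)) = psi (t k0) - psi (t 0).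
  have := big_ord_widen n (fun i => psi (t i.+1) - psi (t i)) (ltnW kn).
  move=> <-; rewrite -(telescope_sumr (fun i => psi (t i)) (leq0n k0)).
  by rewrite big_mkord.
case/andP: tk => tk1 tk2.
have tk := t_lt kn.
set r := (y - _) / _.
have r0 : 0 <= r by rewrite divr_ge0 // subr_ge0 ltW.
have r1 : r <= 1 by rewrite ler_pdivrMr ?subr_gt0 // mul1r lerD2r.
have t0k : t 0 <= t k0 by apply: knot_le (ltnW kn).
have tkn : t k0.+1 <= t n by apply: knot_le.
have m1 := psi_mono t0k (ltW tk1) yn.
have m2 := psi_mono (ltW y0) tk2 tkn.
have l1 := psi_lip t0k (ltW tk) tkn.
have l2 : ell * (t k0.+1 - t k0) <= ell * mesh by rewrite ler_wpM2l // hmesh.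
rewrite ler_norml; apply/andP; split; nra.
Qed.

End Interpolation.
End HatFunctions.

(** * Utilities on a grid as linear functionals *)

Section StackedVectors.
Variables (R : realType) (M : nat) (g : grid R M).
Implicit Types (m : 'I_M) (x : 'rV[R]_M) (v : 'cV[R]_(gsize g)).

Lemma sum_stacked (F : forall m : 'I_M, nat -> R) (v : 'cV[R]_(gsize g)) :
  \sum_s F (tagnat.sig1 s) (tagnat.sig2 s) * v s 0 =
  \sum_m \sum_(i < npts g m) F m i * vcomp v i.
Proof.
rewrite (reindex (@tagnat.rank M (npts g))) /=; last exact: tagnat.rank_bij_on.
under eq_bigr do rewrite /tagnat.sig1 /tagnat.sig2 tagnat.rankK.
rewrite [RHS](@sig_big_dep _ _ _ _ (fun m => 'I_(npts g m)) xpredT (fun _ => xpredT)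
  (fun m i => F m i * vcomp v i)) /=.
by apply: eq_bigr => -[m i] _.
Qed.

Definition attr_weight (m : 'I_M) (y : R) : 'cV[R]_(gsize g) :=
  \col_s ((tagnat.sig1 s == m)%:R * hat (bp g (tagnat.sig1 s)) (tagnat.sig2 s) y).

Definition weight (x : 'rV[R]_M) : 'cV[R]_(gsize g) :=
  \col_s hat (bp g (tagnat.sig1 s)) (tagnat.sig2 s) (x 0 (tagnat.sig1 s)).

Lemma pairing_attr_weight m y v :
  pairing (attr_weight m y) v = \sum_(i < npts g m) vcomp v i * hat (bp g m) i y.
Proof.
rewrite /pairing; under eq_bigr do rewrite mxE.
rewrite (sum_stacked (fun m' i => (m' == m)%:R * hat (bp g m') i y)).
rewrite (bigD1 m) //= eqxx [X in _ + X]big1 ?addr0 => [|m' /negPf ->].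
  by apply: eq_bigr => i _; rewrite mul1r mulrC.
by rewrite big1 // => i _; rewrite !mul0r.
Qed.

Lemma pairing_weight x v :
  pairing (weight x) v = \sum_m pairing (attr_weight m (x 0 m)) v.
Proof.
rewrite /pairing; under eq_bigr do rewrite mxE.
rewrite (sum_stacked (fun m i => hat (bp g m) i (x 0 m))).
apply: eq_bigr => m _; rewrite -/(pairing _ _) pairing_attr_weight.
by apply: eq_bigr => i _; rewrite mulrC.
Qed.

Section OnGrid.
Variables (a b : 'I_M -> R).
Hypothesis g_grid : is_grid a b g.

Lemma bp0 m : bp g m 0 = a m. Proof. by have [] := g_grid m. Qed.
Lemma bp_last m : bp g m (npts g m) = b m. Proof. by have [] := g_grid m. Qed.
Lemma bp_lt m i : (i < npts g m)%N -> bp g m i < bp g m i.+1.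
Proof. by have [_ _] := g_grid m; apply. Qed.

Lemma u_attr_pairing v m y : a m <= y <= b m ->
  u_attr v m y = pairing (attr_weight m y) v.
Proof.
case/andP=> ay yb; rewrite pairing_attr_weight.
apply: (piecewise_linear_hat (@bp_lt m) (vcomp v (m := m))).
  by rewrite bp0.
by rewrite bp_last.
Qed.

Lemma u_add_pairing v x : (forall m, a m <= x 0 m <= b m) ->
  u_add v x = pairing (weight x) v.
Proof.
by move=> xab; rewrite pairing_weight; apply: eq_bigr => m _; exact: u_attr_pairing.
Qed.

Lemma weight01 x i : 0 <= weight x i 0 <= 1.
Proof. by rewrite mxE; apply: (hat01 (@bp_lt _)). Qed.

Lemma bp_bounds m i : (i <= npts g m)%N -> a m <= bp g m i <= b m.
Proof.
by move=> im; rewrite -bp0 -bp_last !(knot_le (@bp_lt m)).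
Qed.

Lemma attr_weight_mono m y y' i : y <= y' ->
  attr_weight m y i 0 <= attr_weight m y' i 0.
Proof.
by move=> yy'; rewrite !mxE ler_wpM2l // (hat_mono (@bp_lt _)).
Qed.

Lemma attr_weight01 m y i : 0 <= attr_weight m y i 0 <= 1.
Proof.
rewrite mxE; have /andP[h0 h1] := hat01 (@bp_lt (tagnat.sig1 i)) y (ltn_ord (tagnat.sig2 i)).
by case: (_ == _); rewrite ?mul1r ?mul0r ?h0 ?h1 ?lexx ?ler01.
Qed.

Lemma bp_step_le_mesh m i : (i < npts g m)%N -> bp g m i.+1 - bp g m i <= mesh g.
Proof.
move=> im; rewrite /mesh.
apply: le_trans (le_bigmax _ _ m).
exact: (le_bigmax _ (fun i : 'I_(npts g m) => bp g m i.+1 - bp g m i) (Ordinal im)).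
Qed.

Lemma mesh_ge0 : 0 <= mesh g.
Proof.
rewrite /mesh; elim/big_ind: _ => // [x y x0 _|m _]; first by rewrite le_max x0.
elim/big_ind: _ => // [x y x0 _|i _]; first by rewrite le_max x0.
by rewrite subr_ge0 ltW // bp_lt.
Qed.

Definition expected_increments (psi : 'I_M -> R -> R) : 'cV[R]_(gsize g) :=
  \col_s (psi (tagnat.sig1 s) (bp g (tagnat.sig1 s) (tagnat.sig2 s).+1)
          - psi (tagnat.sig1 s) (bp g (tagnat.sig1 s) (tagnat.sig2 s))).

Lemma pairing_expected_increments psi m y :
  pairing (attr_weight m y) (expected_increments psi) =
  \sum_(i < npts g m) (psi m (bp g m i.+1) - psi m (bp g m i)) * hat (bp g m) i y.
Proof.
rewrite pairing_attr_weight; apply: eq_bigr => i _; congr (_ * _).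
by rewrite /vcomp mxE /tagnat.sig1 /tagnat.sig2 tagnat.rankK.
Qed.

End OnGrid.
End StackedVectors.

(** * Expected utility *)

Section HasMean.
Context d (T : measurableType d) (R : realType) (P : probability T R).
Implicit Types (X Y : T -> R) (r s : R).

(** Integrability is carried along with the value because expectation is additive
    on integrable variables only. *)
Definition has_mean X r : Prop :=
  P.-integrable setT (EFin \o X) /\ ('E_P[X] = r%:E)%E.

Lemma has_mean0 : has_mean (fun=> 0) 0.
Proof. by split; [exact: integrable0 | rewrite expectation.unlock; exact: integral0]. Qed.

Lemma has_meanD X Y r s : has_mean X r -> has_mean Y s ->
  has_mean (fun w => X w + Y w) (r + s).
Proof.
rewrite /has_mean !expectation.unlock => -[iX EX] [iY EY]; split.
  rewrite (_ : EFin \o _ = (EFin \o X) \+ (EFin \o Y))%E //.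
  exact: integrableD.
rewrite EFinD -EX -EY; exact: (integralD_EFin measurableT iX iY).
Qed.

Lemma has_meanZ c X r : has_mean X r -> has_mean (fun w => c * X w) (c * r).
Proof.
rewrite /has_mean !expectation.unlock => -[iX EX]; split.
  rewrite (_ : EFin \o _ = fun w => c%:E * (EFin \o X) w)%E //.
  exact: integrableZl.
rewrite EFinM -EX; exact: (integralZl measurableT iX c).
Qed.

Lemma has_mean_sum (I : Type) (s : seq I) (X : I -> T -> R) (r : I -> R) :
  (forall i, has_mean (X i) (r i)) ->
  has_mean (fun w => \sum_(i <- s) X i w) (\sum_(i <- s) r i).
Proof.
move=> h; elim: s => [|i s IH].
  rewrite big_nil (_ : (fun w => _) = fun=> 0) ?funeqE; first exact: has_mean0.
  by move=> w; rewrite big_nil.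
rewrite big_cons (_ : (fun w => _) = fun w => X i w + \sum_(i <- s) X i w).
  exact: has_meanD.
by rewrite funeqE => w; rewrite big_cons.
Qed.

Lemma has_meanB X Y r s : has_mean X r -> has_mean Y s ->
  has_mean (fun w => X w - Y w) (r - s).
Proof.
move=> hX hY; have := has_meanD hX (has_meanZ (-1) hY).
rewrite mulN1r; congr has_mean; rewrite funeqE => w; by rewrite mulN1r.
Qed.

Lemma has_mean_unit_interval X : measurable_fun setT X ->
  (forall w, 0 <= X w) -> {ae P, forall w, X w <= 1} ->
  exists2 r, has_mean X r & 0 <= r <= 1.
Proof.
move=> mX X0 X1.
have I0 : (0 <= \int[P]_w (X w)%:E)%E by apply: integral_ge0 => w _; rewrite lee_fin.
have I1 : (\int[P]_w (X w)%:E <= 1)%E.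
  rewrite -(@probability_setT _ _ _ P) -[leRHS]mul1e -integral_cst //.
  apply: ae_ge0_le_integral => //.
  - by move=> w _; rewrite lee_fin.
  - exact/measurable_EFinP.
  - by apply: filterS X1 => w Xw _; rewrite lee_fin.
have Ifin : (\int[P]_w (X w)%:E)%E \is a fin_num.
  by rewrite ge0_fin_numE // (le_lt_trans I1) // ltry.
exists (fine (\int[P]_w (X w)%:E)%E).
  split; last by rewrite expectation.unlock fineK.
  apply/integrableP; split; first exact/measurable_EFinP.
  under eq_integral do rewrite /= ger0_norm //.
  by rewrite (le_lt_trans I1) // ltry.
by rewrite -!lee_fin fineK // I0 I1.
Qed.

Lemma has_mean_le X Y r s : has_mean X r -> has_mean Y s ->
  (forall w, 0 <= X w) -> (forall w, 0 <= Y w) ->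
  {ae P, forall w, X w <= Y w} -> r <= s.
Proof.
rewrite /has_mean => -[iX EX] [iY EY] X0 Y0 XY.
rewrite -lee_fin -EX -EY; apply: expectation_le => //.
- by apply/measurable_EFinP; case/integrableP: iX.
- by apply/measurable_EFinP; case/integrableP: iY.
Qed.

Lemma has_mean_fine X r : has_mean X r -> fine 'E_P[X] = r.
Proof. by case=> _ ->. Qed.

End HasMean.

Section Utility.
Variables (R : realType) (M : nat) (a b : 'I_M -> R).
Hypothesis hab : forall m, a m < b m.
Context (d : measure_display) (T : measurableType d) (P : probability T R).
Variable U : 'I_M -> T -> R -> R.
Hypothesis U_meas : forall m x, x \in `[a m, b m] ->
  measurable_fun [set: T] (fun w => U m w x).
Hypothesis U_mono : forall m w,
  {in `[a m, b m] &, {homo U m w : x y / x <= y}}.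
Hypothesis U_left : forall m w, U m w (a m) = 0.
Hypothesis U_norm : {ae P, forall w, \sum_(m < M) U m w (b m) = 1}.

Definition expected_utility (m : 'I_M) (y : R) : R :=
  fine 'E_P[fun w => U m w y].

Local Notation psi := expected_utility.

Lemma left_in_itv m : a m \in `[a m, b m].
Proof. by rewrite in_itv /= lexx ltW. Qed.

Lemma right_in_itv m : b m \in `[a m, b m].
Proof. by rewrite in_itv /= lexx ltW. Qed.

Lemma utility_ge0 m w y : y \in `[a m, b m] -> 0 <= U m w y.
Proof.
move=> yab; rewrite -(U_left m w); apply: U_mono => //; first exact: left_in_itv.
by move: yab; rewrite in_itv /= => /andP[].
Qed.

Lemma utility_le1 m : {ae P, forall w, forall y, y \in `[a m, b m] -> U m w y <= 1}.
Proof.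
apply: filterS U_norm => w Uw y yab.
apply: (@le_trans _ _ (U m w (b m))).
  apply: U_mono => //; first exact: right_in_itv.
  by move: yab; rewrite in_itv /= => /andP[].
rewrite -Uw (bigD1 m) //= lerDl; apply: sumr_ge0 => m' _.
exact/utility_ge0/right_in_itv.
Qed.

Lemma utility_has_mean m y : y \in `[a m, b m] ->
  has_mean P (fun w => U m w y) (psi m y).
Proof.
move=> yab; have [||r hr _] := @has_mean_unit_interval _ _ _ P _ (U_meas yab).
- by move=> w; exact: utility_ge0.
- by apply: filterS (utility_le1 m) => w; apply.
- by rewrite /psi (has_mean_fine hr).
Qed.

Lemma expected_utility01 m y : y \in `[a m, b m] -> 0 <= psi m y <= 1.
Proof.
move=> yab; have [||r hr r01] := @has_mean_unit_interval _ _ _ P _ (U_meas yab).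
- by move=> w; exact: utility_ge0.
- by apply: filterS (utility_le1 m) => w; apply.
- by rewrite /psi (has_mean_fine hr).
Qed.

Lemma expected_utility_left m : psi m (a m) = 0.
Proof.
rewrite /psi (_ : (fun w => _) = fun=> 0); last by rewrite funeqE => w.
exact/has_mean_fine/has_mean0.
Qed.

Lemma expected_utility_mono m y y' : a m <= y -> y <= y' -> y' <= b m ->
  psi m y <= psi m y'.
Proof.
move=> ay yy' yb.
have h : y \in `[a m, b m] by rewrite in_itv /= ay (le_trans yy').
have h' : y' \in `[a m, b m] by rewrite in_itv /= yb (le_trans ay).
apply: has_mean_le (utility_has_mean h) (utility_has_mean h') _ _ _.
- by move=> w; exact: utility_ge0.
- by move=> w; exact: utility_ge0.
- by apply: nearW => w; exact: U_mono.
Qed.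

(** The modulus is nonnegative almost surely, since a m < b m; so its
    positive part has the same expectation, is integrable, and its mean serves
    as the Lipschitz constant. *)
Lemma expected_utility_lipschitz m (L : {RV P >-> R}) :
  ('E_P[L] < +oo)%E ->
  {ae P, forall w, forall x y, x \in `[a m, b m] -> y \in `[a m, b m] ->
     `|U m w x - U m w y| <= L w * `|x - y|} ->
  exists2 ell, 0 <= ell & forall y y', a m <= y -> y <= y' -> y' <= b m ->
    psi m y' - psi m y <= ell * (y' - y).
Proof.
move=> L_fin U_lip.
pose L' w := Num.max (L w) 0.
have L'meas : measurable_fun setT L' by exact: measurable_maxr.
have L'0 w : 0 <= L' w by rewrite le_max lexx orbT.
have L'E : ('E_P[L'] = 'E_P[L])%E.
  rewrite expectation.unlock; apply: ae_eq_integral => //; try exact/measurable_EFinP.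
  apply: filterS U_lip => w Lw _ /=; congr EFin.
  rewrite /L' max_l //.
  have := Lw _ _ (left_in_itv m) (right_in_itv m).
  move/(le_trans (normr_ge0 _)); rewrite pmulr_lge0 // normr_gt0 subr_eq0.
  by rewrite lt_eqF.
have E0 : (0 <= 'E_P[L'])%E by exact: expectation_ge0.
have Efin : ('E_P[L'])%E \is a fin_num by rewrite ge0_fin_numE // L'E.
have mL' : has_mean P L' (fine 'E_P[L']).
  split; last by rewrite fineK.
  apply/integrableP; split; first exact/measurable_EFinP.
  under eq_integral do rewrite /= ger0_norm //.
  by move: L_fin; rewrite -L'E expectation.unlock.
exists (fine 'E_P[L']) => [|y y' ay yy' yb]; first exact: fine_ge0.
have h : y \in `[a m, b m] by rewrite in_itv /= ay (le_trans yy').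
have h' : y' \in `[a m, b m] by rewrite in_itv /= yb (le_trans ay).
rewrite mulrC; apply: has_mean_le (has_meanB (utility_has_mean h') (utility_has_mean h))
  (has_meanZ (y' - y) mL') _ _ _.
- by move=> w; rewrite subr_ge0; exact: U_mono.
- by move=> w; rewrite mulr_ge0 // subr_ge0.
- apply: filterS U_lip => w Lw; rewrite mulrC.
  apply: le_trans (ler_norm _) _; apply: le_trans (Lw _ _ h' h) _.
  by rewrite [`|y' - y|]ger0_norm ?subr_ge0 // ler_wpM2r ?subr_ge0 // le_max lexx.
Qed.

Lemma theta_expected_utility (X : set 'rV[R]_M) :
  (forall x, X x -> forall m, a m <= x 0 m <= b m) ->
  theta P U X = sup [set \sum_m psi m (x 0 m) | x in X].
Proof.
move=> X_box; rewrite /theta; congr sup; apply: eq_imagel => x Xx.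
apply: has_mean_fine; apply: has_mean_sum => m; apply: utility_has_mean.
by rewrite in_itv /= X_box.
Qed.

Section OnGrid.
Variables (g : grid R M).
Hypothesis g_grid : is_grid a b g.

Local Notation V := (increments U g).

Lemma increments_ge0 w i : 0 <= V w i 0.
Proof.
rewrite mxE subr_ge0; set m := tagnat.sig1 i; set j := tagnat.sig2 i.
by apply: U_mono; rewrite ?in_itv /= ?(bp_bounds g_grid) ?ltW ?(bp_lt g_grid) // ltnW.
Qed.

Lemma sum_increments w : \sum_i V w i 0 = \sum_m U m w (b m).
Proof.
have -> : \sum_i V w i 0 = \sum_m \sum_(i < npts g m) 1 * vcomp (V w) i.
  rewrite -(sum_stacked (fun _ _ => 1)); apply: eq_bigr => i _.
  by rewrite mul1r.
apply: eq_bigr => m _.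
transitivity (\sum_(i < npts g m) (U m w (bp g m i.+1) - U m w (bp g m i))).
  apply: eq_bigr => i _; rewrite mul1r /vcomp mxE /tagnat.sig1 /tagnat.sig2.
  by rewrite tagnat.rankK.
rewrite -(big_mkord xpredT (fun i => U m w (bp g m i.+1) - U m w (bp g m i))).
rewrite (telescope_sumr (fun i => U m w (bp g m i))) //.
by rewrite (bp0 g_grid) (bp_last g_grid) U_left subr0.
Qed.

Lemma increments_simplex : {ae P, forall w, @simplex R (gsize g) (V w)}.
Proof.
by apply: filterS U_norm => w Uw; split; [rewrite sum_increments | exact: increments_ge0].
Qed.

Lemma pairing_increments_has_mean (c : 'cV[R]_(gsize g)) :
  has_mean P (fun w => pairing c (V w)) (pairing c (expected_increments g psi)).
Proof.
apply: has_mean_sum => i; rewrite mxE.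
under eq_fun do rewrite mxE.
apply: has_meanZ; apply: has_meanB; apply: utility_has_mean;
  by rewrite in_itv /= (bp_bounds g_grid) // ltnW.
Qed.

Lemma measurable_pairing_increments (c : 'cV[R]_(gsize g)) :
  measurable_fun setT (fun w => pairing c (V w)).
Proof.
by have [/integrableP[/measurable_EFinP]] := pairing_increments_has_mean c.
Qed.

End OnGrid.
End Utility.

(** * Uniform deviation of the sample mean *)

Lemma continuous_pairing (R : realType) (n : nat) (c : 'cV[R]_n) :
  continuous (pairing c).
Proof.
have ci i : continuous (fun w : 'cV[R]_n => c i 0 * w i 0).
  move=> v; apply: (@continuousM _ 'cV[R]_n (fun=> c i 0) (fun w => w i 0)).
    exact: cst_continuous.
  exact: coord_continuous.
rewrite /pairing; elim: (index_enum _) => [|i s IH] v.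
  have -> : (fun w : 'cV[R]_n => \sum_(i <- [::]) c i 0 * w i 0) = fun=> 0.
    by rewrite funeqE => w; rewrite big_nil.
  exact: cst_continuous.
have -> : (fun w : 'cV[R]_n => \sum_(j <- i :: s) c j 0 * w j 0) =
    (fun w => c i 0 * w i 0 + \sum_(j <- s) c j 0 * w j 0).
  by rewrite funeqE => w; rewrite big_cons.
exact: (@continuousD _ _ 'cV[R]_n (fun w => c i 0 * w i 0) _ v (ci i v) (IH v)).
Qed.

Lemma borel_vec_simplexC (R : realType) (n : nat) :
  borel_vec (~` (@simplex R n)).
Proof.
apply: borel_vec_open; have -> : ~` (@simplex R n) =
    pairing (const_mx 1) @^-1` [set r | r != 1] `|`
    \bigcup_(i in [set: 'I_n]) ((fun v : 'cV[R]_n => v i 0) @^-1` [set r | r < 0]).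
  have sumE (v : 'cV[R]_n) : pairing (const_mx 1) v = \sum_i v i 0.
    by apply: eq_bigr => i _; rewrite mxE mul1r.
  apply/seteqP; split=> v.
    move=> nv; apply: contrapT => /not_orP[/= v1 v0]; apply: nv; split.
      by rewrite -sumE; apply/eqP/negPn/negP.
    by move=> i; rewrite leNgt; apply/negP => vi; apply: v0; exists i.
  case=> [/= /eqP v1 [v1' _]|[i _ /= vi] [_ /(_ i)]]; first by rewrite sumE in v1.
  by rewrite leNgt vi.
apply: openU.
  by apply: open_comp (@open_neq _ 1) => v _; exact: continuous_pairing.
apply: bigcup_open => i _.
by apply: open_comp (@open_lt _ 0) => v _; exact: coord_continuous.
Qed.

Section Sampling.
Variables (R : realType) (M : nat) (a b : 'I_M -> R).
Hypothesis hab : forall m, a m < b m.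
Context (d : measure_display) (T : measurableType d) (P : probability T R).
Variable U : 'I_M -> T -> R -> R.
Hypothesis U_meas : forall m x, x \in `[a m, b m] ->
  measurable_fun [set: T] (fun w => U m w x).
Hypothesis U_mono : forall m w,
  {in `[a m, b m] &, {homo U m w : x y / x <= y}}.
Hypothesis U_left : forall m w, U m w (a m) = 0.
Hypothesis U_norm : {ae P, forall w, \sum_(m < M) U m w (b m) = 1}.
Variables (g : grid R M).
Hypothesis g_grid : is_grid a b g.
Context (d' : measure_display) (T' : measurableType d') (Q : probability T' R).
Variables (N : nat) (W : 'I_N -> T' -> 'cV[R]_(gsize g)).
Hypothesis W_iid : iid_copies P (increments U g) Q W.
Hypothesis N_gt0 : (0 < N)%N.

Local Notation V := (increments U g).
Local Notation psi := (expected_utility P U).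
Local Notation EV := (expected_increments g psi).

Definition simplex_sample (w : T') : Prop := forall k, @simplex R (gsize g) (W k w).

Lemma nonsimplex_sample_null : (mu_ext Q [set w | ~ simplex_sample w] <= 0)%E.
Proof.
have [Wmeas Wlaw _] := W_iid.
have bC := @borel_vec_simplexC R (gsize g).
apply: le_trans (mu_ext_subadditive (C := xpredT) (r := fun=> 0)
  (F := fun k => W k @^-1` (~` (@simplex R (gsize g)))) _ _) _; last by rewrite big1.
  by move=> w /existsNP[k hk]; exists k.
move=> k _; rewrite measurable_mu_extE; last exact: Wmeas.
rewrite [X in (X <= _)%E](Wlaw k _ bC).
have mE : measurable [set w | pairing (const_mx 1) (V w) != 1].
  have := measurable_pairing_increments hab U_meas U_mono U_left U_norm g_grid (const_mx 1).
  move=> mp; rewrite (_ : [set w | _] = (fun w => pairing (const_mx 1) (V w)) @^-1` ~` [set 1]).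
    by rewrite -[_ @^-1` _]setTI; apply: mp => //; exact: measurableC.
  by apply/seteqP; split=> w /= /eqP.
have VE : V @^-1` (~` (@simplex R (gsize g))) = [set w | pairing (const_mx 1) (V w) != 1].
  have sumE w : pairing (const_mx 1) (V w) = \sum_i V w i 0.
    by apply: eq_bigr => i _; rewrite [const_mx _ _ _]mxE mul1r.
  apply/seteqP; split=> w /=.
    move=> nV; apply/eqP => V1; apply: nV; split; first by rewrite -sumE.
    exact: (increments_ge0 U_mono g_grid).
  by rewrite sumE => /eqP nV [].
rewrite VE le_eqVlt; apply/orP; left; apply/eqP.
apply: measure_negligible => //.
have [A [mA PA VA]] := increments_simplex U_mono U_left U_norm g_grid.
exists A; split=> // w nw; apply: VA => /= Vw.
by move: nw; rewrite -VE; apply.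
Qed.

Section OneAttribute.
Variables (m : 'I_M) (Lam : R) (t : nat -> R) (J : nat).
Hypothesis psi_lip : forall y y', a m <= y -> y <= y' -> y' <= b m ->
  psi m y' - psi m y <= Lam / (b m - a m) * (y' - y).
Hypothesis t_gt0 : forall j, 0 < t j.
Hypothesis t_le : forall j, (j <= J)%N -> t j <= 2 * (Lam / 2 ^+ j).

Let pt (s : R) : R := a m + s * (b m - a m).

Let pt_in s : 0 <= s -> s <= 1 -> a m <= pt s <= b m.
Proof. by move=> s0 s1; rewrite /pt; have := hab m => h; apply/andP; split; nra. Qed.

Let pt_mono s s' : s <= s' -> pt s <= pt s'.
Proof. by move=> ss'; rewrite /pt; have := hab m => h; nra. Qed.

(* The functional that measures the increment of the utility of attribute m over
   the i-th dyadic cell of level j. *)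
Let cell (j i : nat) : 'cV[R]_(gsize g) :=
  attr_weight g m (pt (i.+1%:R / 2 ^+ j)) - attr_weight g m (pt (i%:R / 2 ^+ j)).

Let dyadic_le j i : i%:R / 2 ^+ j <= i.+1%:R / 2 ^+ j :> R.
Proof. by rewrite ler_wpM2r ?ler_nat // invr_ge0 exprn_ge0. Qed.

Let cell01 j i k : 0 <= cell j i k 0 <= 1.
Proof.
have := attr_weight_mono g_grid m k (pt_mono (dyadic_le j i)).
have /andP[] := attr_weight01 g_grid m (pt (i.+1%:R / 2 ^+ j)) k.
have /andP[] := attr_weight01 g_grid m (pt (i%:R / 2 ^+ j)) k.
have -> : cell j i k 0 = attr_weight g m (pt (i.+1%:R / 2 ^+ j)) k 0 -
    attr_weight g m (pt (i%:R / 2 ^+ j)) k 0.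
  by rewrite /cell; move: (attr_weight g m _) (attr_weight g m _) => u v; rewrite !mxE.
lra.
Qed.

Lemma attribute_psi_lip y y' : a m <= y -> y <= y' -> y' <= b m ->
  pairing (attr_weight g m y') EV - pairing (attr_weight g m y) EV
  <= Lam / (b m - a m) * (y' - y).
Proof.
move=> ay yy' yb; rewrite !pairing_expected_increments -sumrB.
under eq_bigr do rewrite -mulrBr.
apply: (interpolant_lip (bp_lt g_grid (m := m))); rewrite ?(bp0 g_grid) ?(bp_last g_grid) //.
Qed.

Lemma cell_mean_le j i : (i < 2 ^ j)%N -> pairing (cell j i) EV <= Lam / 2 ^+ j.
Proof.
move=> ij; have p0 : 0 < 2 ^+ j :> R by rewrite exprn_gt0.
have /andP[h1 _] : a m <= pt (i%:R / 2 ^+ j) <= b m.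
  apply: pt_in; first by rewrite divr_ge0 // ltW.
  by rewrite ler_pdivrMr // mul1r -natrX ler_nat ltnW.
have /andP[_ h2] : a m <= pt (i.+1%:R / 2 ^+ j) <= b m.
  apply: pt_in; first by rewrite divr_ge0 // ltW.
  by rewrite ler_pdivrMr // mul1r -natrX ler_nat.
rewrite pairingBl; apply: le_trans (attribute_psi_lip h1 (pt_mono (dyadic_le j i)) h2) _.
rewrite le_eqVlt; apply/orP; left; apply/eqP; rewrite /pt -natr1; field.
by rewrite subr_eq0 !gt_eqF.
Qed.

(** If all cell increments of the sample mean were within 2 t j of their
    expectations, [dyadic_chaining] would exclude the deviation.  Hence some
    cell is far off, and there are 2^j cells at level j. *)
Lemma attribute_deviation :
  (mu_ext Q [set w | (simplex_sample w /\ exists2 y, a m <= y <= b m &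
     \sum_(j < J.+1) 2 * t j + Lam / 2 ^+ J <
     `|pairing (attr_weight g m y) (sample_mean (W ^~ w)) -
       pairing (attr_weight g m y) EV|)%R]
   <= (\sum_(j < J.+1) 2 ^+ j *
        (2 * expR (- (N%:R * (t j ^+ 2 / (8 * (Lam / 2 ^+ j)))))))%:E)%E.
Proof.
pose far j i w := simplex_sample w /\ N%:R * (2 * t j) <=
  `|\sum_k (pairing (cell j i) (W k w) - pairing (cell j i) EV)|.
apply: (mu_ext_subadditive (C := xpredT)
   (F := fun j : 'I_J.+1 => [set w | exists2 i : 'I_(2 ^ j), xpredT i & far j i w])).
  move=> w [sw [y yab dev]]; apply: contrapT => nbad.
  have NR : 0 < N%:R :> R by rewrite ltr0n.
  have ms := sample_mean_simplex sw N_gt0.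
  have close j i : (j <= J)%N -> (i < 2 ^ j)%N ->
      `|pairing (cell j i) (sample_mean (W ^~ w)) - pairing (cell j i) EV| <= 2 * t j.
    move=> jJ ij; rewrite leNgt; apply/negP => h; apply: nbad.
    exists (Ordinal (jJ : (j < J.+1)%N)) => //=; exists (Ordinal ij) => //; split=> //=.
    rewrite sumrB sumr_const card_ord -[pairing _ EV *+ N]mulr_natl.
    have -> : \sum_k pairing (cell j i) (W k w) =
        N%:R * pairing (cell j i) (sample_mean (W ^~ w)).
      by rewrite pairing_sample_mean mulrA mulfV ?mul1r // gt_eqF.
    by rewrite -mulrBr normrM (ger0_norm (ltW NR)) ler_pM2l // ltW.
  pose s := (y - a m) / (b m - a m).
  have bam : 0 < b m - a m by rewrite subr_gt0.
  have sy : pt s = y by rewrite /pt /s divfK ?gt_eqF // addrC subrK.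
  have s01 : 0 <= s <= 1.
    case/andP: yab => ay yb.
    apply/andP; split; first by rewrite divr_ge0 ?subr_ge0 // ltW.
    by rewrite ler_pdivrMr // mul1r lerD2r.
  have := @dyadic_chaining R (fun s => pairing (attr_weight g m (pt s)) (sample_mean (W ^~ w)))
    (fun s => pairing (attr_weight g m (pt s)) EV) (fun j => 2 * t j) Lam J.
  move=> /(_ _ _ _ _ _ _ s s01); rewrite sy => chain.
  move: dev; rewrite ltNge => /negP; apply; apply: chain => {s sy s01}.
  - move=> s s' s0 ss' s1; apply: ler_sum => k _; apply: ler_wpM2r; first by case: ms.
    exact/(attr_weight_mono g_grid)/pt_mono.
  - move=> s s' s0 ss' s1; rewrite !pairing_expected_increments.
    apply: (interpolant_mono (bp_lt g_grid (m := m)) _ (pt_mono ss')).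
    rewrite (bp0 g_grid) (bp_last g_grid); exact: (expected_utility_mono hab U_meas U_mono U_left U_norm).
  - move=> s s' s0 ss' s1.
    have /andP[h1 _] := pt_in s0 (le_trans ss' s1).
    have /andP[_ h2] := pt_in (le_trans s0 ss') s1.
    apply: le_trans (attribute_psi_lip h1 (pt_mono ss') h2) _.
    rewrite le_eqVlt; apply/orP; left; apply/eqP; rewrite /pt; field.
    by rewrite gt_eqF.
  - have z v : pairing (attr_weight g m (pt 0)) v = 0.
      rewrite /pt mul0r addr0 pairing_attr_weight -(bp0 g_grid).
      exact: (sum_hat_left (bp_lt g_grid (m := m))).
    by rewrite !z.
  - by move=> j; rewrite mulr_ge0 // ltW.
  - by move=> j i jJ ij; rewrite -!pairingBl; exact: close.
move=> j _.
apply: le_trans (mu_ext_subadditive (C := xpredT) (F := fun i : 'I_(2 ^ j) => [set w | far j i w])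
  (r := fun=> 2 * expR (- (N%:R * (t j ^+ 2 / (8 * (Lam / 2 ^+ j)))))) _ _) _.
- by move=> w.
- move=> i _; apply: le_trans (iid_concentration (f := pairing (cell j i))
    (mu := pairing (cell j i) EV) W_iid _ _ _ _ _ _ (t_gt0 j) (t_le _)).
  + apply: le_mu_ext => w [sw dev]; split=> // k.
    by apply: pairing_simplex => // l; exact: cell01.
  + exact: continuous_pairing.
  + exact: (measurable_pairing_increments hab U_meas U_mono U_left U_norm g_grid).
  + move=> w; apply: sumr_ge0 => k _; rewrite mulr_ge0 //.
      by have /andP[] := cell01 j i k.
    exact: (increments_ge0 U_mono g_grid).
  + apply: filterS (increments_simplex U_mono U_left U_norm g_grid) => w Vw.
    by have /andP[] := pairing_simplex Vw (cell01 j i).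
  + by have [_] := pairing_increments_has_mean hab U_meas U_mono U_left U_norm g_grid (cell j i).
  + exact: cell_mean_le.
  + by rewrite -ltnS.
- by rewrite sumr_const card_ord -[_ *+ (2 ^ j)]mulr_natl natrX.
Qed.

End OneAttribute.
(** The choice t j = eta / 8 (3/4)^j makes the chained deviations 2 t j sum to at
    most eta, and the last level J, with 2^J between Lam / eta and
    2 Lam / eta, contributes a further Lam / 2^J <= eta.  The upper bound on
    2^J gives t j <= 2 (Lam / 2^j) on all levels j <= J. *)
Lemma uniform_deviation (m : 'I_M) (Lam eta : R) :
  (forall y y', a m <= y -> y <= y' -> y' <= b m ->
     psi m y' - psi m y <= Lam / (b m - a m) * (y' - y)) ->
  0 < eta -> eta <= Lam -> 24 <= N%:R * eta ^+ 2 / (512 * Lam) ->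
  (mu_ext Q [set w | (simplex_sample w /\ exists2 y, a m <= y <= b m &
     2 * eta < `|pairing (attr_weight g m y) (sample_mean (W ^~ w)) -
       pairing (attr_weight g m y) EV|)%R]
   <= (4 * expR (- (N%:R * eta ^+ 2 / (512 * Lam))))%:E)%E.
Proof.
move=> lip eta0 etaL x24.
have Lam0 : 0 < Lam by exact: lt_le_trans etaL.
have [J /andP[J1 J2]] : exists J : nat, Lam / eta <= 2 ^+ J <= 2 * (Lam / eta).
  by apply: pow2_between; rewrite ler_pdivlMr // mul1r.
pose t j : R := eta / 8 * (3 / 4) ^+ j.
have p0 j : 0 < 2 ^+ j :> R by rewrite exprn_gt0.
have t0 j : 0 < t j by rewrite mulr_gt0 ?exprn_gt0 ?divr_gt0.
have tle j : (j <= J)%N -> t j <= 2 * (Lam / 2 ^+ j).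
  move=> jJ; rewrite mulrA ler_pdivlMr //.
  have -> : t j * 2 ^+ j = eta / 8 * (3 / 4 * 2) ^+ j by rewrite exprMn mulrA.
  apply: (@le_trans _ _ (eta / 8 * 2 ^+ J)).
    apply: ler_wpM2l; first by rewrite divr_ge0 // ltW.
    apply: (@le_trans _ _ (2 ^+ j)).
      by rewrite lerXn2r ?nnegrE ?mulr_ge0 ?divr_ge0 //; lra.
    by rewrite ler_eXn2l // ltr1n.
  apply: (@le_trans _ _ (eta / 8 * (2 * (Lam / eta)))).
    by apply: ler_wpM2l => //; rewrite divr_ge0 // ltW.
  have -> : eta / 8 * (2 * (Lam / eta)) = Lam / 4 by field; rewrite gt_eqF.
  lra.
have dev := attribute_deviation lip t0 tle.
apply: (le_trans _ (le_trans dev _)).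
  apply: le_mu_ext => w [sw [y yab hy]]; split=> //; exists y => //; apply: le_lt_trans hy.
  have s1 : \sum_(j < J.+1) 2 * t j <= eta.
    rewrite /t; under eq_bigr do rewrite mulrA.
    rewrite -mulr_sumr.
    have h30 : 0 <= 3 / 4 :> R by lra.
    have h34 : 3 / 4 < 1 :> R by lra.
    have hs := geometric_sum_le J.+1 h30 h34.
    have h4 : (1 - 3 / 4)^-1 = 4 :> R.
      by rewrite (_ : 1 - 3 / 4 = 4^-1) ?invrK //; field.
    rewrite h4 in hs.
    have := ler_wpM2l (_ : 0 <= 2 * (eta / 8)) hs.
    by move=> /(_ ltac:(lra)); lra.
  have s2 : Lam / 2 ^+ J <= eta.
    by rewrite ler_pdivrMr // mulrC -ler_pdivrMr.
  lra.
rewrite lee_fin; set x := _ / (512 * Lam) in x24 *.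
(* The exponent at level j is x times (3/4)^(2 j) 2^j = (9/8)^j. *)
have -> : \sum_(j < J.+1) 2 ^+ j *
    (2 * expR (- (N%:R * (t j ^+ 2 / (8 * (Lam / 2 ^+ j)))))) =
  2 * \sum_(j < J.+1) 2 ^+ j * expR (- (x * (9 / 8) ^+ j)).
  rewrite mulr_sumr; apply: eq_bigr => j _; rewrite mulrCA; congr (_ * (_ * _)).
  congr (expR (- _)); rewrite /x /t.
  have -> : (9 / 8) ^+ j = ((3 / 4) ^+ j) ^+ 2 * 2 ^+ j :> R.
    by rewrite exprAC -exprMn; congr (_ ^+ _); field.
  by field; rewrite !gt_eqF.
have := chaining_tail_sum J.+1 x24; lra.
Qed.

End Sampling.

(** * Comparison of the optimal values *)

Lemma sup_image_close (R : realType) (S : Type) (X : set S) (f h : S -> R)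
    (e B : R) : X !=set0 -> (forall x, X x -> `|f x - h x| <= e) ->
  (forall x, X x -> `|h x| <= B) ->
  `|sup [set f x | x in X] - sup [set h x | x in X]| <= e.
Proof.
move=> [x0 Xx0] fh hB.
have ne (k : S -> R) : [set k x | x in X] !=set0 by exists (k x0); exists x0.
have ubh : has_ubound [set h x | x in X].
  exists B => _ [x Xx <-]; exact: le_trans (ler_norm _) (hB x Xx).
have ubf : has_ubound [set f x | x in X].
  exists (B + e) => _ [x Xx <-].
  have := fh x Xx; have := hB x Xx; rewrite !ler_norml.
  by move=> /andP[? ?] /andP[? ?]; lra.
rewrite ler_norml; apply/andP; split.
  have : sup [set h x | x in X] <= sup [set f x | x in X] + e; last lra.
  apply: ge_sup => // _ [x Xx <-].
  have : f x <= sup [set f x | x in X] by apply: ub_le_sup => //; exists x.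
  by have := fh x Xx; rewrite ler_norml => /andP[? ?]; lra.
have : sup [set f x | x in X] <= sup [set h x | x in X] + e; last lra.
apply: ge_sup => // _ [x Xx <-].
have : h x <= sup [set h x | x in X] by apply: ub_le_sup => //; exists x.
by have := fh x Xx; rewrite ler_norml => /andP[? ?]; lra.
Qed.

Lemma inf_close (R : realType) (A : set R) (c e : R) : A !=set0 ->
  (forall z, A z -> `|z - c| <= e) -> `|inf A - c| <= e.
Proof.
move=> [z0 Az0] Ac; have lb : lbound A (c - e).
  by move=> z /Ac; rewrite ler_norml => /andP[? ?]; lra.
have h1 : c - e <= inf A by apply: lb_le_inf => //; exists z0.
have h2 : inf A <= z0 by apply: ge_inf => //; exists (c - e).
have := Ac _ Az0; rewrite !ler_norml => /andP[? ?]; apply/andP; split; lra.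
Qed.

(** The three errors at each alternative: radius of the set of means, deviation
    of the sample mean and interpolation, the last two once per attribute. *)
Lemma theta_elp_close (R : realType) (M : nat) (a b : 'I_M -> R) (g : grid R M)
    (X : set 'rV[R]_M) (N : nat) (W : 'I_N -> 'cV[R]_(gsize g))
    (psi : 'I_M -> R -> R) (gamma tau ell dlt : R) :
  is_grid a b g -> X !=set0 -> (forall x, X x -> forall m, a m <= x 0 m <= b m) ->
  (1 < N)%N -> (forall k, @simplex R (gsize g) (W k)) -> 0 <= gamma -> 0 < tau ->
  (forall m, psi m (a m) = 0) ->
  (forall m y, a m <= y <= b m -> 0 <= psi m y <= 1) ->
  (forall m y y', a m <= y -> y <= y' -> y' <= b m -> psi m y <= psi m y') ->
  (forall m y y', a m <= y -> y <= y' -> y' <= b m ->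
     psi m y' - psi m y <= ell * (y' - y)) -> 0 <= ell ->
  (forall m y, a m <= y <= b m ->
     `|pairing (attr_weight g m y) (sample_mean W) -
       pairing (attr_weight g m y) (expected_increments g psi)| <= dlt) ->
  `|theta_elp X gamma W - sup [set \sum_m psi m (x 0 m) | x in X]|
  <= tau + gamma / (2 * tau) + M%:R * (dlt + ell * mesh g).
Proof.
move=> g_grid X0 X_box N1 Ws gam0 tau0 psi_a psi01 psi_mono psi_lip ell0 dev.
rewrite /theta_elp; apply: (sup_image_close (B := M%:R)) => // x Xx; last first.
  rewrite ger0_norm; last first.
    by apply: sumr_ge0 => m _; have /andP[] := psi01 m _ (X_box x Xx m).
  rewrite -[leRHS]mulr1 mulr_natl -[X in _ *+ X]card_ord -sumr_const.
  by apply: ler_sum => m _; have /andP[] := psi01 m _ (X_box x Xx m).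
have xb := X_box x Xx.
have inner : `|inf [set u_add v x | v in mean_set gamma W] -
    pairing (weight g x) (sample_mean W)| <= tau + gamma / (2 * tau).
  apply: inf_close.
    exists (u_add (sample_mean W) x); exists (sample_mean W) => //.
    exact: (sample_mean_in_mean_set Ws (ltnW N1)).
  move=> _ [v vF <-]; rewrite (u_add_pairing g_grid _ xb).
  apply: ellipsoid_deviation vF => // i; exact: (weight01 g_grid).
have outer : `|pairing (weight g x) (sample_mean W) - \sum_m psi m (x 0 m)|
    <= M%:R * (dlt + ell * mesh g).
  rewrite pairing_weight -sumrB (le_trans (ler_norm_sum _ _ _)) //.
  rewrite mulr_natl -[X in _ *+ X]card_ord -sumr_const ler_sum // => m _.
  have h1 := dev m _ (xb m); have /andP[ax xb'] := xb m.
  have h2 : `|pairing (attr_weight g m (x 0 m)) (expected_increments g psi) -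
      psi m (x 0 m)| <= ell * mesh g.
    rewrite pairing_expected_increments.
    have := interpolation_error (bp_lt g_grid (m := m)) (psi := psi m)
      (ell := ell) (mesh := mesh g).
    rewrite (bp0 g_grid) (bp_last g_grid) => ie.
    have := ie (@psi_mono m) (@psi_lip m) ell0 (x 0 m) ax xb'.
    rewrite psi_a subr0; apply; last exact: (mesh_ge0 g_grid).
    by move=> i; exact: bp_step_le_mesh.
  have -> : pairing (attr_weight g m (x 0 m)) (sample_mean W) - psi m (x 0 m) =
    (pairing (attr_weight g m (x 0 m)) (sample_mean W) -
     pairing (attr_weight g m (x 0 m)) (expected_increments g psi)) +
    (pairing (attr_weight g m (x 0 m)) (expected_increments g psi) -
      psi m (x 0 m)) by ring.
  by apply: le_trans (ler_normD _ _) _; exact: lerD.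
set z := inf _ in inner *; set y := pairing _ _ in inner outer.
have -> : z - \sum_m psi m (x 0 m) = (z - y) + (y - \sum_m psi m (x 0 m)) by ring.
by apply: le_trans (ler_normD _ _) _; exact: lerD.
Qed.

(** * Grid size and sample size *)

(** Every attribute is cut into gsize / M cells of equal length. *)
Lemma evenly_spread_mesh (R : realType) (M : nat) (a b : 'I_M -> R) (g : grid R M) :
  (0 < M)%N -> (forall m, a m < b m) -> is_grid a b g -> evenly_spread a b g ->
  mesh g * (gsize g)%:R <= M%:R * \sum_m (b m - a m).
Proof.
move=> hM hab g_grid [npts_eq bpE].
have n0 m : (0 < npts g m)%N.
  rewrite lt0n; apply/eqP => n0; have := hab m.
  by rewrite -(bp0 g_grid) -(bp_last g_grid) n0 ltxx.
have ab0 m : 0 <= b m - a m by rewrite subr_ge0 ltW.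
have sizeE m : (gsize g)%:R = M%:R * (npts g m)%:R :> R.
  rewrite -natrM; congr _%:R; rewrite /gsize (eq_bigr (fun=> npts g m)) => [|m' _].
    by rewrite sum_nat_const card_ord.
  exact: npts_eq.
have step m i : (i < npts g m)%N ->
    bp g m i.+1 - bp g m i = (b m - a m) / (npts g m)%:R.
  move=> im; rewrite (bpE m i.+1 im) (bpE m i (ltnW im)).
  have nz : (npts g m)%:R != 0 :> R by rewrite pnatr_eq0 -lt0n.
  by rewrite -[i.+1%:R]natr1; field.
have s0 : 0 < (gsize g)%:R :> R.
  by rewrite (sizeE (Ordinal hM)) mulr_gt0 // ltr0n.
rewrite -ler_pdivlMr //.
have bnd0 : 0 <= M%:R * (\sum_m (b m - a m)) / (gsize g)%:R.
  by rewrite divr_ge0 // mulr_ge0 // sumr_ge0.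
rewrite /mesh; apply: bigmax_le => // m _; apply: bigmax_le => // i _.
rewrite step // (sizeE m) -mulf_div divff ?mul1r; last first.
  by rewrite pnatr_eq0 -lt0n (leq_ltn_trans _ (ltn_ord m)).
apply: ler_wpM2r; first by rewrite invr_ge0.
by rewrite (bigD1 m) //= lerDl sumr_ge0.
Qed.

Lemma first_index_below (R : realType) (gamma : nat -> R) :
  gamma @ \oo --> (0 : R) ->
  exists f : R -> nat, forall e, 0 < e ->
    gamma (f e) <= e /\ forall n, gamma n <= e -> (f e <= n)%N.
Proof.
move=> g0; have ex (e : R) : exists n : nat, 0 < e ->
    gamma n <= e /\ forall k, gamma k <= e -> (n <= k)%N.
  have [e0|] := boolP (0 < e); last by exists 0%N.
  have small : exists n, gamma n <= e.
    have /cvgrPdist_le /(_ e e0) [n _ hn] := g0.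
    exists n; have := hn n (leqnn n); rewrite /= sub0r normrN.
    exact: le_trans (ler_norm _).
  by case: (ex_minnP small) => n gn minn; exists n.
by have [f hf] := choice ex; exists f.
Qed.

(** For evenly spread grids the threshold is explicit and of order 1 / eps;
    otherwise it comes from the convergence of the mesh, without a rate. *)
Lemma grid_size_threshold (R : realType) (M : nat) (a b : 'I_M -> R)
    (G : set (grid R M)) (c : R) :
  (0 < M)%N -> (forall m, a m < b m) -> (forall g, G g -> is_grid a b g) ->
  (forall delta : R, 0 < delta -> exists n : nat,
     forall g, G g -> (n <= gsize g)%N -> mesh g <= delta) -> 0 < c ->
  exists2 I0 : R -> R,
    forall eps, 0 < eps -> 0 < I0 eps /\
      forall g, G g -> I0 eps <= (gsize g)%:R -> mesh g <= c * eps &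
    (forall g, G g -> evenly_spread a b g) ->
      exists2 K : R, 0 < K & forall eps, 0 < eps -> I0 eps <= K * eps^-1.
Proof.
move=> hM hab G_grid G_fine c0.
have [even|neven] := pselect (forall g, G g -> evenly_spread a b g).
  pose H := M%:R * (\sum_m (b m - a m)) / c.
  have H0 : 0 < H.
    rewrite divr_gt0 // mulr_gt0 ?ltr0n // (bigD1 (Ordinal hM)) //=.
    rewrite ltr_pwDl ?subr_gt0 //; apply: sumr_ge0 => m _.
    by rewrite subr_ge0 ltW.
  exists (fun eps => H / eps); last by move=> _; exists H.
  move=> eps eps0; split; first by rewrite divr_gt0.
  move=> g Gg hg; have s0 : 0 < (gsize g)%:R :> R.
    by apply: lt_le_trans hg; rewrite divr_gt0.
  rewrite -(ler_pM2r s0).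
  apply: le_trans (evenly_spread_mesh hM hab (G_grid g Gg) (even g Gg)) _.
  have -> : M%:R * \sum_m (b m - a m) = H / eps * (c * eps).
    by rewrite /H; field; rewrite !gt_eqF.
  by rewrite mulrC ler_wpM2l // mulr_ge0 // ltW.
have ex (eps : R) : exists n : nat, 0 < eps ->
    forall g, G g -> (n <= gsize g)%N -> mesh g <= c * eps.
  have [e0|] := boolP (0 < eps); last by exists 0%N.
  by have [n hn] := G_fine (c * eps) (mulr_gt0 c0 e0); exists n.
have [f hf] := choice ex.
exists (fun eps => (f eps).+1%:R) => // eps eps0; split=> // g Gg.
by rewrite ler_nat => /ltnW; exact: hf.
Qed.

Unset Implicit Arguments.

Theorem theorem1 (R : realType) (M : nat) (hM : (0 < M)%N)
  (a b : 'I_M -> R) (hab : forall m, a m < b m)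
  (d : measure_display) (T : measurableType d) (P : probability T R)
  (U : 'I_M -> T -> R -> R)
  (U_meas : forall m x, x \in `[a m, b m] ->
     measurable_fun [set: T] (fun w => U m w x))
  (U_cont : forall m w, {within `[a m, b m], continuous (U m w)})
  (U_mono : forall m w,
     {in `[a m, b m] &, {homo U m w : x y / x <= y}})
  (U_left : forall m w, U m w (a m) = 0)
  (U_norm : {ae P, forall w, \sum_(m < M) U m w (b m) = 1})
  (L : 'I_M -> {RV P >-> R})
  (L_fin : forall m, ('E_P[L m] < +oo)%E)
  (U_lip : forall m, {ae P, forall w, forall x y,
     x \in `[a m, b m] -> y \in `[a m, b m] ->
     `|U m w x - U m w y| <= L m w * `|x - y|})
  (X : set 'rV[R]_M) (X_compact : compact X) (X_neq0 : X !=set0)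
  (X_box : forall x, X x -> forall m, a m <= x 0 m <= b m)
  (G : set (grid R M)) (G_grid : forall g, G g -> is_grid a b g)
  (G_fine : forall delta : R, 0 < delta -> exists n : nat,
     forall g, G g -> (n <= gsize g)%N -> mesh g <= delta)
  (Sigma_nonsing : forall g, G g ->
     cov_mx P (fun w => drop_last R (gsize g) *m increments U g w) \in unitmx)
  (gamma : nat -> R) (gamma_dec : nonincreasing_seq gamma)
  (gamma_lim : gamma @ \oo --> (0 : R)) :
  exists (eps0 : R) (I0 : R -> R) (N0 : R -> R -> R),
  [/\ 0 < eps0,
      (forall eps alpha : R, 0 < eps < eps0 -> 0 < alpha < 1 ->
        [/\ 0 < I0 eps, 0 < N0 eps alpha &
          forall (N : nat) (g : grid R M), N0 eps alpha <= N%:R ->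
          G g -> I0 eps <= (gsize g)%:R ->
          forall (d' : measure_display) (T' : measurableType d')
            (Q : probability T' R) (W : 'I_N -> T' -> 'cV[R]_(gsize g)),
          iid_copies P (increments U g) Q W ->
          (mu_ext Q [set w | (eps <= `|theta_elp X (gamma N) (W ^~ w) -
                                       theta P U X|)%R] <= alpha%:E)%E]),
      ((forall g, G g -> evenly_spread a b g) ->
        exists2 K : R, 0 < K &
          forall eps : R, 0 < eps < eps0 -> I0 eps <= K * eps^-1) &
      sample_size_order gamma eps0 N0].
Proof.
have gamma_ge0 n : 0 <= gamma n.
  have := nonincreasing_cvgn_ge gamma_dec (cvgP _ gamma_lim) n.
  by rewrite (cvg_lim _ gamma_lim).
have MR : 1 <= M%:R :> R by rewrite ler1n.
pose psi := expected_utility P U.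
have [ell [ell0 psi_lip]] : exists ell : R, 0 <= ell /\
    forall m y y', a m <= y -> y <= y' -> y' <= b m ->
      psi m y' - psi m y <= ell * (y' - y).
  have ex m := expected_utility_lipschitz hab U_meas U_mono U_left U_norm (L_fin m) (U_lip m).
  pose l m := s2val (cid2 (ex m)).
  have l0 m : 0 <= l m by rewrite /l; case: cid2.
  exists (\sum_m l m); split; first exact: sumr_ge0.
  move=> m y y' ay yy' yb.
  apply: (@le_trans _ _ (l m * (y' - y))); first by rewrite /l; case: cid2 => ? ? /=; apply.
  by apply: ler_wpM2r; rewrite ?subr_ge0 // (bigD1 m) //= lerDl sumr_ge0.
have psi_left m : psi m (a m) = 0 by exact: expected_utility_left.
have psi01 m y : a m <= y <= b m -> 0 <= psi m y <= 1.
  move=> yab; apply: (expected_utility01 hab U_meas U_mono U_left U_norm).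
  by rewrite in_itv.
have psi_mono m y y' : a m <= y -> y <= y' -> y' <= b m -> psi m y <= psi m y'.
  exact: (expected_utility_mono hab U_meas U_mono U_left U_norm).
(* One constant for all attributes, at least 1 so that eps / (8 M) <= Lam. *)
pose Lam := 1 + \sum_m ell * (b m - a m).
have terms0 m : 0 <= ell * (b m - a m) by rewrite mulr_ge0 // subr_ge0 ltW.
have Lam1 : 1 <= Lam by rewrite lerDl sumr_ge0.
have psi_lip' m y y' : a m <= y -> y <= y' -> y' <= b m ->
    psi m y' - psi m y <= Lam / (b m - a m) * (y' - y).
  move=> ay yy' yb; apply: le_trans (psi_lip m _ _ ay yy' yb) _.
  apply: ler_wpM2r; rewrite ?subr_ge0 // ler_pdivlMr ?subr_gt0 //.
  rewrite /Lam (bigD1 m) //= addrCA lerDl addr_ge0 // sumr_ge0 //.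
(* With eta = eps / (8 M) the exponent N eta^2 / (512 Lam) equals N eps^2 / D.
   The summand ln (4 M) of C0 pays for the union over the attributes, and 24 is
   required by the chaining. *)
pose D := 512 * Lam * (8 * M%:R) ^+ 2.
pose C0 := 24 + ln (4 * M%:R) : R.
have C024 : 24 <= C0 by rewrite lerDl ln_ge0 //; lra.
have D1 : 1 <= D.
  by rewrite /D mulr_ege1 // ?exprn_ege1 //; lra.
have [first firstP] := first_index_below gamma_lim.
(* Makes the interpolation errors M ell mesh at most eps / 4. *)
pose c := (4 * M%:R * (ell + 1))^-1.
have c0 : 0 < c by rewrite invr_gt0 !mulr_gt0 //; lra.
have [I0 I0P I0even] := grid_size_threshold hM hab G_grid G_fine c0.
pose N0 eps alpha := Num.max (D * (C0 + `|ln alpha|) / eps ^+ 2)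
  (first (eps ^+ 2 / 32))%:R.
exists 1, I0, N0; split => //.
- move=> eps alpha /andP[e0 e1] /andP[al0 al1].
  have [I0pos I0mesh] := I0P eps e0.
  have e20 : 0 < eps ^+ 2 by rewrite exprn_gt0.
  have e21 : eps ^+ 2 <= 1 by rewrite exprn_ile1 // ltW.
  have base : 24 <= D * (C0 + `|ln alpha|) / eps ^+ 2.
    rewrite ler_pdivlMr //; have := normr_ge0 (ln alpha); nra.
  split=> //; first by rewrite lt_max; apply/orP; left; lra.
  move=> N g N0N Gg I0g d' T' Q W W_iid.
  have g_grid := G_grid g Gg.
  move: N0N; rewrite /N0 ge_max => /andP[ND Nfirst].
  have N24 : 24 <= N%:R :> R by exact: le_trans ND.
  have N1 : (1 < N)%N by rewrite -(ltr_nat R); lra.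
  have Npos : (0 < N)%N by exact: ltnW.
  have gamN : gamma N <= eps ^+ 2 / 32.
    have [h _] := firstP (eps ^+ 2 / 32) (divr_gt0 e20 (ltr0n R 32)).
    by apply: le_trans h; apply: gamma_dec; rewrite -(ler_nat R).
  pose eta := eps / (8 * M%:R).
  have eta0 : 0 < eta by rewrite divr_gt0 ?mulr_gt0 //; lra.
  have etaL : eta <= Lam.
    rewrite ler_pdivrMr ?mulr_gt0 //; last lra.
    by nra.
  pose x := N%:R * eta ^+ 2 / (512 * Lam).
  have xE : x = N%:R * eps ^+ 2 / D.
    by rewrite /x /eta /D; field; rewrite !gt_eqF //; lra.
  have xge : C0 + `|ln alpha| <= x.
    rewrite xE ler_pdivlMr; last lra.
    by rewrite mulrC -ler_pdivrMr.
  have x24 : 24 <= x by have := normr_ge0 (ln alpha); lra.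
  pose bad m := [set w | (simplex_sample W w /\ exists2 y, a m <= y <= b m &
     2 * eta < `|pairing (attr_weight g m y) (sample_mean (W ^~ w)) -
       pairing (attr_weight g m y) (expected_increments g psi)|)%R].
  have badP m : (mu_ext Q (bad m) <= (4 * expR (- x))%:E)%E.
    exact: (uniform_deviation hab U_meas U_mono U_left U_norm g_grid W_iid Npos
      (psi_lip' m) eta0 etaL x24).
  have cover w : eps <= `|theta_elp X (gamma N) (W ^~ w) - theta P U X| ->
      (~ simplex_sample W w) \/ exists m, bad m w.
    move=> far; apply: contrapT => /not_orP[/contrapT Ww nbad].
    have dev m y : a m <= y <= b m ->
        `|pairing (attr_weight g m y) (sample_mean (W ^~ w)) -
          pairing (attr_weight g m y) (expected_increments g psi)| <= 2 * eta.
      move=> yab; rewrite leNgt; apply/negP => h; apply: nbad.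
      by exists m; split=> //; exists y.
    (* tau = eps / 8 and gamma <= eps^2 / 32 make the radius at most eps / 4,
       so that the three errors add up to 3 eps / 4 < eps. *)
    have tau0 : 0 < eps / 8 by rewrite divr_gt0.
    have := theta_elp_close (psi := psi) g_grid X_neq0 X_box N1 Ww (gamma_ge0 N) tau0.
    move=> /(_ ell (2 * eta)); rewrite -(theta_expected_utility hab U_meas U_mono U_left U_norm X_box).
    move=> close.
    have {}close := le_trans far (close psi_left psi01 psi_mono psi_lip ell0 dev).
    have t1 : gamma N / (2 * (eps / 8)) <= eps / 8.
      rewrite ler_pdivrMr ?mulr_gt0 //.
      by apply: le_trans gamN _; rewrite le_eqVlt; apply/orP; left; apply/eqP; field.
    have t2 : M%:R * (2 * eta) = eps / 4 by rewrite /eta; field; lra.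
    have t3 : M%:R * (ell * mesh g) <= eps / 4.
      have := I0mesh g Gg I0g; rewrite /c => hmesh.
      have m0 := mesh_ge0 g_grid.
      have Mell : 0 < M%:R * (ell + 1) by rewrite mulr_gt0 //; lra.
      apply: (@le_trans _ _ (M%:R * (ell + 1) * mesh g)).
        by rewrite mulrA; apply: ler_wpM2r => //; apply: ler_wpM2l; lra.
      apply: le_trans (ler_wpM2l (ltW Mell) hmesh) _.
      by rewrite le_eqVlt; apply/orP; left; apply/eqP; field; lra.
    by have := mulrDr M%:R (2 * eta) (ell * mesh g); lra.
  apply: (@le_trans _ _ (mu_ext Q ([set w | ~ simplex_sample W w] `|`
      [set w | exists2 m, xpredT m & bad m w]))).
    apply: le_mu_ext => w /cover[|[m bm]]; first by left.
    by right; exists m.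
  apply: le_trans (outer_measureU2 _ _ _) _.
  rewrite -[leRHS]add0e; apply: leeD.
    have null := nonsimplex_sample_null hab U_meas U_mono U_left U_norm g_grid W_iid.
    exact: null.
  apply: le_trans (mu_ext_subadditive (C := xpredT) (F := bad)
    (r := fun=> 4 * expR (- x)) _ _) _; [by []|by move=> m _; exact: badP|].
  rewrite lee_fin sumr_const card_ord -[_ *+ M]mulr_natl.
  have M4 : 0 < 4 * M%:R :> R by rewrite mulr_gt0 //; lra.
  have ex : expR (- x) <= (4 * M%:R)^-1 * alpha.
    rewrite -[(4 * M%:R)^-1]lnK ?posrE ?invr_gt0 // -[X in _ * X]lnK ?posrE //.
    rewrite -expRD ler_expR lnV ?posrE //.
    have : `|ln alpha| = - ln alpha by rewrite ler0_norm // ln_le0 // ltW.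
    by move: xge; rewrite /C0; lra.
  apply: (@le_trans _ _ (M%:R * (4 * ((4 * M%:R)^-1 * alpha)))).
    by rewrite !ler_wpM2l //.
  by rewrite le_eqVlt; apply/orP; left; apply/eqP; field; lra.
- move=> even; have [K K0 hK] := I0even even.
  by exists K => // eps /andP[e0 _]; exact: hK.
- move=> alpha1 /andP[a10 a11].
  have l1 : 0 < `|ln alpha1| by rewrite normr_gt0 ln_eq0 // lt_eqF.
  (* The constant C0 is absorbed by |ln alpha| >= |ln alpha1| > 0, and K >= 32
     makes gamma n <= eps^2 / K imply gamma n <= eps^2 / 32. *)
  exists (Num.max 32 (D * (C0 / `|ln alpha1| + 1))); first by rewrite lt_max ltr0n.
  set K := Num.max _ _.
  have K32 : 32 <= K by rewrite le_max lexx.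
  have KD : D * (C0 / `|ln alpha1| + 1) <= K by rewrite le_max lexx orbT.
  move=> eps alpha /andP[e0 e1] /andP[al0 al1] n gn.
  have e20 : 0 < eps ^+ 2 by rewrite exprn_gt0.
  have l1l : `|ln alpha1| <= `|ln alpha|.
    by rewrite !ler0_norm ?ln_le0 ?(ltW a11) ?(le_trans al1 (ltW a11)) // lerN2 ler_ln ?posrE.
  rewrite ge_max; apply/andP; split; rewrite le_max; apply/orP.
    left; rewrite mulrA; apply: ler_wpM2r; first by rewrite invr_ge0 ltW.
    apply: (@le_trans _ _ (D * (C0 / `|ln alpha1| + 1) * `|ln alpha|)); last first.
      by apply: ler_wpM2r.
    rewrite -mulrA; apply: ler_wpM2l; first lra.
    rewrite mulrDl mul1r lerD2r -mulrA ler_peMr //; first lra.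
    by rewrite mulrC ler_pdivlMr // mul1r.
  right; rewrite ler_nat; apply: (firstP (eps ^+ 2 / 32) (divr_gt0 e20 (ltr0n R 32))).2.
  apply: le_trans gn _; rewrite ler_pM2l // lef_pV2 ?posrE //; lra.
Qed.
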